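(* Let $f$ be a non-negative bounded function on $\mathbb{N}$ and let $\Phi$ be a Følner sequence on $\mathbb{N}$ such that $\langle 1,f\rangle_\Phi$ exists. For every $\epsilon>0$ there exist a subsequence $\Psi$ of $\Phi$ and a non-principal ultrafilter $\mathfrak{p}$ on $\mathbb{N}$ such that $\langle \mathsf{R}^m f,\mathsf{R}^{\mathfrak{p}} f\rangle_\Psi$ exists for all $m\in\mathbb{N}$ and $$\lim_{m\to\mathfrak{p}}\langle \mathsf{R}^m f,\mathsf{R}^{\mathfrak{p}} f\rangle_\Psi\ \ge\ \langle 1,f\rangle_\Psi^2-\epsilon.$$
   Context: A Følner sequence in $\mathbb{N}$ is a sequence $\Phi\colon N\mapsto\Phi_N$ of finite non-empty subsets of $\mathbb{N}$ with $|(\Phi_N+m)\triangle\Phi_N|/|\Phi_N|\to0$ for all $m\in\mathbb{N}$. For $f,h\colon\mathbb{N}\to\mathbb{C}$, $\langle f,h\rangle_\Phi=\lim_{N\to\infty}\frac{1}{|\Phi_N|}\sum_{n\in\Phi_N}f(n)\overline{h(n)}$ whenever this limit exists. For bounded $f$ and $m\in\mathbb{N}$, $(\mathsf{R}^m f)(n)=f(n+m)$; for an ultrafilter $\mathfrak{p}$ on $\mathbb{N}$, $(\mathsf{R}^{\mathfrak{p}}f)(n)=\lim_{m\to\mathfrak{p}}f(n+m)$, where $\lim_{m\to\mathfrak{p}}$ denotes the ultrafilter limit of a bounded sequence. *)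

(* Defs.v *)
From HB Require Import structures.
From mathcomp Require Import all_boot all_order all_algebra finmap.
From mathcomp Require Import all_classical all_reals all_analysis.
Set Implicit Arguments. Unset Strict Implicit. Unset Printing Implicit Defensive.
Import Order.TTheory GRing.Theory Num.Theory numFieldNormedType.Exports.
Local Open Scope classical_set_scope.
Local Open Scope ring_scope.
Local Open Scope fset_scope.

(* Convention: the paper's N = {1,2,3,...} is modelled by nat via n <-> n+1;
   so shifts "m in N" are the m with 0 < m. *)

Definition fshift (A : {fset nat}) (m : nat) : {fset nat} := [fset (n + m)%N | n in A].

Definition fsymdiff (A B : {fset nat}) : {fset nat} := (A `\` B) `|` (B `\` A).

Definition Folner {R : realType} (Phi : nat -> {fset nat}) : Prop :=
  (forall N, Phi N != fset0) /\
  forall m : nat, (0 < m)%N ->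
    (fun N => (#|` fsymdiff (fshift (Phi N) m) (Phi N)|%:R / #|` Phi N|%:R : R))
      @ \oo --> (0 : R).

(* the averages (1/|Phi_N|) sum_{n in Phi_N} f(n) h(n)  (real valued, so no conjugation) *)
Definition avg {R : realType} (Phi : nat -> {fset nat}) (f h : nat -> R) (N : nat) : R :=
  (#|` Phi N|%:R)^-1 * \sum_(n <- Phi N) f n * h n.

Definition inner_exists {R : realType} (Phi : nat -> {fset nat}) (f h : nat -> R) : Prop :=
  cvgn (avg Phi f h).

(* <f,h>_Phi (its value, meaningful when it exists) *)
Definition inner {R : realType} (Phi : nat -> {fset nat}) (f h : nat -> R) : R :=
  limn (avg Phi f h).

Definition shiftR {R : realType} (m : nat) (f : nat -> R) : nat -> R := fun n => f (n + m)%N.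

Definition ulim {R : realType} (p : set_system nat) (a : nat -> R) : R := lim (a @ p).

Definition shiftRp {R : realType} (p : set_system nat) (f : nat -> R) : nat -> R :=
  fun n => ulim p (fun m => f (n + m)%N).

Definition nonprincipal (p : set_system nat) : Prop :=
  forall n : nat, p <> principal_filter n.

Definition subsequence_of (Psi Phi : nat -> {fset nat}) : Prop :=
  exists sigma : nat -> nat, (forall k, (sigma k < sigma k.+1)%N) /\ Psi = Phi \o sigma.

(* Main.v *)
Require Import Defs.
From HB Require Import structures.
From mathcomp Require Import all_boot all_order all_algebra finmap.
From mathcomp Require Import all_classical all_reals all_analysis.
From mathcomp Require Import ring lra.
Set Implicit Arguments.
Unset Strict Implicit.
Unset Printing Implicit Defensive.
Import Order.TTheory GRing.Theory Num.Theory numFieldNormedType.Exports.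
Local Open Scope classical_set_scope.
Local Open Scope ring_scope.

(** Idea.  All limits are replaced by finitely additive shift-invariant means
[M] on bounded functions: ultrafilter limits of Folner averages.  After passing
to a subsequence, [f] is approximated in the seminorm [M (g ^ 2)] by a finite
combination [u] of its shifts whose orbit is covered by finitely many small
balls (the colour classes of [cpt]), in such a way that [f - u] is, up to a
small error, weakly mixing: for every bounded [v], the correlation of
[T^m (f - u)] with [v] is small off a set of [m] of mean zero.  Hence, if every
member of an ultrafilter [q] has positive mean and [v = R^q f], the limit along
[m -> q] of the correlations of [T^m f] and [v] is almost the correlation of
[T^r u] and [v], where [r] is fixed by the colour class lying in [q].

Averaging over [q] turns this into the iterated mean over [n], then [l], of
[u (n + r l) f (n + l)].  It is bounded below by means of the positive-definite
kernel [kap x y = M (T^x 1_C * T^y 1_C)], [C] a colour class of positive mean: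
convolution by [kap] does not see the difference between [T^(r l) u] and
[T^l u], and [kap] minus its mean value is still positive definite, so the
iterated mean is almost at least [M f ^ 2].  A suitable [q] is then found by
Bergelson's intersectivity argument.  Positivity is transferred to iterated
means, where limits cannot be exchanged, by [mean_psd]. *)

(** * Means on bounded functions *)

Section Bounded.
Context {R : realType}.
Implicit Types T U : Type.

Definition bnd {T} (F : T -> R) := exists B, forall x, `|F x| <= B.

Lemma bnd_pos {T} {F : T -> R} : bnd F -> exists2 B, 0 < B & forall x, `|F x| <= B.
Proof.
move=> [B FB]; exists (`|B| + 1); first by rewrite ltr_wpDl.
by move=> x; rewrite (le_trans (FB x))// (le_trans (ler_norm _))// lerDl.
Qed.

Lemma bnd_cst T (c : R) : bnd (fun _ : T => c).
Proof. by exists `|c|. Qed.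

Lemma bndD T (F G : T -> R) : bnd F -> bnd G -> bnd (fun x => F x + G x).
Proof.
move=> [A FA] [B GB]; exists (A + B) => x.
by rewrite (le_trans (ler_normD _ _))// lerD.
Qed.

Lemma bndN T (F : T -> R) : bnd F -> bnd (fun x => - F x).
Proof. by move=> [A FA]; exists A => x; rewrite normrN. Qed.

Lemma bndM T (F G : T -> R) : bnd F -> bnd G -> bnd (fun x => F x * G x).
Proof. by move=> [A FA] [B GB]; exists (A * B) => x; rewrite normrM ler_pM. Qed.

Lemma bnd_norm T (F : T -> R) : bnd F -> bnd (fun x => `|F x|).
Proof. by move=> [A FA]; exists A => x; rewrite normr_id. Qed.

Lemma bndX T (F : T -> R) n : bnd F -> bnd (fun x => F x ^+ n).
Proof.
move=> bF; elim: n => [|n ih]; first exact: (@bnd_cst T 1).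
have [B hB] := bndM bF ih; exists B => x; rewrite exprS; exact: hB.
Qed.

Lemma bnd_comp T U (f : U -> R) (g : T -> U) : bnd f -> bnd (fun x => f (g x)).
Proof. by move=> [A FA]; exists A. Qed.

Lemma bnd_comp2 T U V (f : U -> V -> R) (g : T -> U) (h : T -> V) :
  bnd (fun p : U * V => f p.1 p.2) -> bnd (fun x => f (g x) (h x)).
Proof. by move=> [A FA]; exists A => x; exact: (FA (g x, h x)). Qed.

Lemma bnd_sum T I (s : seq I) (F : I -> T -> R) :
  (forall i, bnd (F i)) -> bnd (fun x => \sum_(i <- s) F i x).
Proof.
move=> bF; elim: s => [|i s [B hB]].
  by exists 0 => x; rewrite big_nil normr0.
have [A hA] := bF i; exists (A + B) => x.
by rewrite big_cons (le_trans (ler_normD _ _))// lerD.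
Qed.

Lemma bnd_nat T (b : T -> bool) : bnd (fun x => (b x)%:R : R).
Proof. by exists 1 => x; case: (b x); rewrite ?normr1 ?normr0. Qed.

End Bounded.

(** Placeholder, filled in once [bnd_mean] shows that means preserve boundedness in a parameter;
    [bd] then also goes under iterated means. *)
Ltac bd_mean := fail.

Ltac bd := lazymatch goal with
  | |- bnd (fun _ => ?c) => apply: bnd_cst
  | |- bnd (fun x => @?Fbd x + @?Gbd x) => apply: (@bndD _ _ Fbd Gbd); bd
  | |- bnd (fun x => - @?Fbd x) => apply: (@bndN _ _ Fbd); bd
  | |- bnd (fun x => @?Fbd x * @?Gbd x) => apply: (@bndM _ _ Fbd Gbd); bd
  | |- bnd (fun x => @?Fbd x ^+ ?n) => apply: (@bndX _ _ Fbd n); bd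
  | |- bnd (fun x => `|@?Fbd x|) => apply: (@bnd_norm _ _ Fbd); bd
  | |- bnd (fun x => (nat_of_bool (@?bbd x))%:R) => apply: (@bnd_nat _ _ bbd)
  | |- bnd (fun x => \sum_(i <- ?s) (@?Fbd x i)) =>
      refine (@bnd_sum _ _ _ s (fun i x => Fbd x i) _); cbv beta; intro; bd
  | |- bnd _ => first [ by auto | bd_mean
      | lazymatch goal with
        | |- bnd (fun x => ?f (@?g x)) => apply: (@bnd_comp _ _ _ f g); bd
        | |- bnd (fun x => ?f (@?g x) (@?h x)) => apply: (@bnd_comp2 _ _ _ _ f g h); bd
        | |- _ => idtac end ]
  | |- _ => idtac
  end.

Section Mean.
Context {R : realType}.

(** A finitely additive expectation: limits cannot be taken inside it, two means need not commute,
    and values off bounded functions are unconstrained. *)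
Record is_mean (T : Type) (M : (T -> R) -> R) : Prop := IsMean {
  meanD : forall F G, bnd F -> bnd G -> M (fun x => F x + G x) = M F + M G;
  meanZ : forall c F, bnd F -> M (fun x => c * F x) = c * M F;
  mean_ge0 : forall F, bnd F -> (forall x, 0 <= F x) -> 0 <= M F;
  mean1 : M (fun=> 1) = 1 }.

Context {T : Type} {M : (T -> R) -> R} (hM : is_mean M).

Lemma eq_mean F G : (forall x, F x = G x) -> M F = M G.
Proof. by move=> FG; congr M; apply/funext. Qed.

Lemma mean_cst c : M (fun=> c) = c.
Proof.
rewrite -[RHS]mulr1 -(mean1 hM) -(meanZ hM)//; last exact: bnd_cst.
by apply: eq_mean => x; rewrite mulr1.
Qed.

Lemma meanZr c F : bnd F -> M (fun x => F x * c) = M F * c.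
Proof. by move=> bF; rewrite [RHS]mulrC -(meanZ hM)//; apply: eq_mean => x; rewrite mulrC. Qed.

Lemma meanN F : bnd F -> M (fun x => - F x) = - M F.
Proof. by move=> bF; rewrite -mulN1r -(meanZ hM)//; apply: eq_mean => x; rewrite mulN1r. Qed.

Lemma meanB F G : bnd F -> bnd G -> M (fun x => F x - G x) = M F - M G.
Proof. by move=> bF bG; rewrite (meanD hM)// ?meanN//; bd. Qed.

Lemma mean_sum I (s : seq I) (F : I -> T -> R) : (forall i, bnd (F i)) ->
  M (fun x => \sum_(i <- s) F i x) = \sum_(i <- s) M (F i).
Proof.
move=> bF; elim: s => [|i s ih].
  by rewrite big_nil -[RHS](mean_cst 0); apply: eq_mean => x; rewrite big_nil.
rewrite big_cons -ih -(meanD hM)//; last bd.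
by apply: eq_mean => x; rewrite big_cons.
Qed.

Lemma le_mean F G : bnd F -> bnd G -> (forall x, F x <= G x) -> M F <= M G.
Proof.
move=> bF bG FG; rewrite -subr_ge0 -meanB//; apply: (mean_ge0 hM); first bd.
by move=> x; rewrite subr_ge0.
Qed.

Lemma mean_leB F B : bnd F -> (forall x, F x <= B) -> M F <= B.
Proof. by move=> bF FB; rewrite -(mean_cst B); apply: le_mean => //; bd. Qed.

Lemma mean_geB F B : bnd F -> (forall x, B <= F x) -> B <= M F.
Proof. by move=> bF FB; rewrite -(mean_cst B); apply: le_mean => //; bd. Qed.

Lemma mean_norm F : bnd F -> `|M F| <= M (fun x => `|F x|).
Proof.
move=> bF; rewrite ler_norml -meanN; last bd.
apply/andP; split; apply: le_mean => [||x]; try by bd.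
  by rewrite lerNl -normrN ler_norm.
by rewrite ler_norm.
Qed.

Lemma mean_normB F B : (forall x, `|F x| <= B) -> `|M F| <= B.
Proof.
move=> FB; have bF : bnd F by exists B.
by rewrite (le_trans (mean_norm bF))//; apply: mean_leB => //; bd.
Qed.

Lemma mean_ex_le F e : bnd F -> 0 < e -> exists x, F x <= M F + e.
Proof.
move=> bF e0; apply: contrapT => nF.
have : M F + e <= M F.
  apply: mean_geB => // x; rewrite leNgt; apply/negP => Fx.
  by apply: nF; exists x; rewrite ltW.
by rewrite gerDl leNgt e0.
Qed.

Lemma mean_CS F G : bnd F -> bnd G ->
  M (fun x => F x * G x) ^+ 2 <= M (fun x => F x ^+ 2) * M (fun x => G x ^+ 2).
Proof.
move=> bF bG.
set a := M (fun x => F x ^+ 2); set b := M (fun x => _ * _).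
set c := M (fun x => G x ^+ 2).
have c0 : 0 <= c by apply: (mean_ge0 hM) => [|x]; [bd|exact: sqr_ge0].
have a0 : 0 <= a by apply: (mean_ge0 hM) => [|x]; [bd|exact: sqr_ge0].
have P s t : 0 <= s ^+ 2 * a + s * t * b *+ 2 + t ^+ 2 * c.
  have -> : s ^+ 2 * a + s * t * b *+ 2 + t ^+ 2 * c = M (fun x => (s * F x + t * G x) ^+ 2).
    rewrite /a /b /c -mulrnAl -!(meanZ hM); try bd.
    rewrite -!(meanD hM); try bd.
    by apply: eq_mean => x; ring.
  by apply: (mean_ge0 hM) => [|x]; [bd|exact: sqr_ge0].
have [c00|cn0] := eqVneq c 0.
  have [b00|bn0] := eqVneq b 0; first by rewrite b00 expr0n /= mulr_ge0.
  (* If [c = 0] the form is affine in [t]; this [t] gives it the value -1, so [b] must vanish. *)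
  have := P 1 (- (a + 1) / b / 2); rewrite c00.
  have -> : 1 ^+ 2 * a + 1 * (- (a + 1) / b / 2) * b *+ 2 + (- (a + 1) / b / 2) ^+ 2 * 0 = -1.
    by field.
  by rewrite lerNr oppr0 ler10.
have := P c (- b).
have -> : c ^+ 2 * a + c * - b * b *+ 2 + (- b) ^+ 2 * c = c * (a * c - b ^+ 2) by ring.
by rewrite pmulr_rge0 ?subr_ge0// lt_neqAle eq_sym cn0.
Qed.

Lemma mean_sqr_le F : bnd F -> M F ^+ 2 <= M (fun x => F x ^+ 2).
Proof.
move=> bF; have := @mean_CS F (fun=> 1) bF (bnd_cst _ _).
rewrite (eq_mean (F := fun x => F x * 1) (G := F)) => [|x]; last by rewrite mulr1.
by rewrite expr1n mean_cst mulr1.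
Qed.

End Mean.

Section Means.
Context {R : realType}.

Lemma bnd_mean {T U : Type} (M : (U -> R) -> R) (hM : is_mean M) (K : T -> U -> R) :
  bnd (fun p : T * U => K p.1 p.2) -> bnd (fun x => M (K x)).
Proof.
by move=> [B hB]; exists B => x; apply: (mean_normB hM) => y; exact: (hB (x, y)).
Qed.

End Means.

Ltac bd_mean ::= match goal with h : is_mean ?N |- bnd (fun x => ?N (@?Kbd x)) =>
  refine (bnd_mean h (K := Kbd) _); cbv beta; bd end.

Section Means.
Context {R : realType}.

Lemma bnd_curry {T U : Type} (K : T -> U -> R) x :
  bnd (fun p : T * U => K p.1 p.2) -> bnd (K x).
Proof. by move=> [B hB]; exists B => y; exact: (hB (x, y)). Qed.

(** The order of integration is part of the construction, as [M] and [N] need not commute. Linearity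
    and positivity are enough to run Cauchy-Schwarz and von Neumann's argument in two variables. *)
Lemma is_mean_prod {T U : Type} (M : (T -> R) -> R) (N : (U -> R) -> R) :
  is_mean M -> is_mean N ->
  is_mean (fun F : T * U -> R => M (fun x => N (fun y => F (x, y)))).
Proof.
move=> hM hN.
have bN F : bnd F -> bnd (fun x => N (fun y => F (x, y))).
  by move=> [B hB]; apply: (bnd_mean hN); exists B => p; exact: hB.
have bN1 (F : T * U -> R) x : bnd F -> bnd (fun y => F (x, y)) by move=> [B hB]; exists B.
split.
- move=> F G bF bG; rewrite -(meanD hM); [|exact: bN|exact: bN].
  by apply: eq_mean => x; rewrite (meanD hN); [|exact: bN1|exact: bN1].
- move=> c F bF; rewrite -(meanZ hM); last exact: bN.
  by apply: eq_mean => x; rewrite (meanZ hN)//; exact: bN1.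
- move=> F bF F0; apply: (mean_ge0 hM); first exact: bN.
  by move=> x; apply: (mean_ge0 hN) => //; exact: bN1.
- by rewrite -[RHS](mean1 hM); apply: eq_mean => x; rewrite (mean1 hN).
Qed.

(* The greedy choice of the next point controls the partial energy
   [\sum k + 2 (J - |L|) \sum g] of a list [L], where [g] is the inner mean of [k]. *)
Lemma mean_psd {T : Type} (M : (T -> R) -> R) (k : T -> T -> R) : is_mean M ->
  bnd (fun p : T * T => k p.1 p.2) -> (forall x y, k x y = k y x) ->
  (forall L : seq T, 0 <= \sum_(x <- L) \sum_(y <- L) k x y) ->
  0 <= M (fun x => M (k x)).
Proof.
move=> hM bk ksym kpsd.
have bk1 x : bnd (k x) by exact: bnd_curry.
have bg := bnd_mean hM bk.
set g := fun x => M (k x) in bg *; set X := M g.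
have [C C0 hC] := bnd_pos bk.
rewrite leNgt; apply/negP => X0.
(* After [J] choices the energy is at most [J * (C + 1 - X + J * X)], which is negative for this
   [J]. *)
have [J hJ] : exists J : nat, (C + 1 - X) / (- X) < J%:R.
  by exists (Num.bound ((C + 1 - X) / (- X))); rewrite archi_boundP// divr_ge0; lra.
have key j : (j <= J)%N -> exists2 L : seq T, size L = j &
    \sum_(x <- L) \sum_(y <- L) k x y + 2 * (J - j)%:R * \sum_(x <- L) g x <=
    j%:R * (C + 1 + 2 * J%:R * X) - (j%:R * (j%:R + 1)) * X.
  elim: j => [_|j ih jJ].
    by exists [::] => //; rewrite !big_nil; lra.
  have [L sL hL] := ih (ltnW jJ).
  (* Appending [y] changes the partial energy by [k y y + phi y - 2 * \sum g]. As [M phi] is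
     [2 * \sum g + 2 * (J - j - 1) * X], some [y] changes it by at most
     [C + 1 + 2 * (J - j - 1) * X]. *)
  pose phi y := 2 * \sum_(x <- L) k x y + 2 * (J - j.+1)%:R * g y.
  have bphi : bnd phi.
    by apply: bndD; apply: bndM; try bd; move=> y; apply: bnd_comp2.
  have Mphi : M phi = 2 * \sum_(x <- L) g x + 2 * (J - j.+1)%:R * X.
    rewrite (meanD hM) ?(meanZ hM) ?(mean_sum hM)//; try bd.
  have [y hy] := mean_ex_le hM bphi (@ltr01 R).
  exists (y :: L); first by rewrite /= sL.
  have -> : \sum_(x <- y :: L) \sum_(z <- y :: L) k x z =
      k y y + 2 * \sum_(z <- L) k z y + \sum_(x <- L) \sum_(z <- L) k x z.
    have E x : \sum_(z <- y :: L) k x z = k x y + \sum_(z <- L) k x z by rewrite big_cons.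
    rewrite (eq_bigr _ (fun x _ => E x)) big_cons.
    rewrite big_split /=; have -> : \sum_(i <- L) k y i = \sum_(i <- L) k i y by exact: eq_bigr.
    by ring.
  rewrite big_cons.
  have kyy : k y y <= C by rewrite (le_trans (ler_norm _))// (hC (y, y)).
  move: hy; rewrite Mphi /phi.
  have nJ : (J - j.+1)%:R = J%:R - j%:R - 1 :> R.
    by rewrite natrB// -natr1; ring.
  move: hL; rewrite nJ natrB ?(ltnW jJ)// -natr1.
  set a := \sum_(x <- L) _; set b := \sum_(x <- L) g x; set c := \sum_(i <- L) k i y.
  nra.
have [L sL hL] := key _ (leqnn J).
move: hL; rewrite subnn mulr0 mul0r addr0; move: (kpsd L).
set S := \sum_(x <- L) _ => S0 SJ.
have nX : 0 < - X by lra.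
move: hJ; rewrite ltr_pdivrMr// => hJ.
have J0 : 0 < J%:R :> R.
  by have : 0 < J%:R * - X; [lra|rewrite pmulr_lgt0].
have : 0 <= J%:R * (C + 1 - X + J%:R * X) by lra.
by rewrite pmulr_rge0//; lra.
Qed.

End Means.

(** * Almost invariant averages *)

Section Ergodic.
Context {R : realType} {T : Type} {M : (T -> R) -> R} (hM : is_mean M).

Definition avgz {U : Type} (X : seq nat) (Z : nat -> U -> R) (w : U) : R :=
  (size X)%:R^-1 * \sum_(x <- X) Z x w.

Lemma bnd_avgz U X (Z : nat -> U -> R) : (forall x, bnd (Z x)) -> bnd (avgz X Z).
Proof. by move=> bZ; rewrite /avgz; bd. Qed.

Lemma mean_sq_avgzE X (W : nat -> T -> R) : (forall x, bnd (W x)) ->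
  M (fun w => avgz X W w ^+ 2) =
  avgz X (fun y _ => avgz X (fun x _ => M (fun w => W x w * W y w)) tt) tt.
Proof.
move=> bW; rewrite {2 3}/avgz.
have E y : \sum_(x <- X) M (fun w => W x w * W y w) =
    M (fun w => \sum_(x <- X) W x w * W y w) by rewrite -(mean_sum hM)// => x; bd.
under eq_bigr do rewrite E.
rewrite -mulr_sumr -(mean_sum hM); last by move=> y; bd.
rewrite -!(meanZ hM); try bd.
apply: eq_mean => w; rewrite /avgz exprMn expr2 -mulrA; congr (_ * (_ * _)).
by rewrite expr2 mulr_sumr; apply: eq_bigr => y _; rewrite mulr_suml.
Qed.

(* Von Neumann's argument: averages of almost minimal norm are almost invariant. *)
Lemma ergodic_avg (Z : nat -> T -> R) (e : R) : (forall x, bnd (Z x)) ->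
  (forall h x y, M (fun w => Z (x + h)%N w * Z (y + h)%N w) = M (fun w => Z x w * Z y w)) ->
  0 < e -> exists2 X : seq nat, (0 < size X)%N &
    forall h, M (fun w => (avgz X Z w - avgz X (fun x => Z (x + h)%N) w) ^+ 2) <= e.
Proof.
move=> bZ Zinv e0.
pose N X := M (fun w => avgz X Z w ^+ 2).
pose E := [set r | exists2 X, (0 < size X)%N & r = N X].
have N0 X : 0 <= N X.
  by apply: (mean_ge0 hM) => [|w]; [apply: bndX; exact: bnd_avgz|exact: sqr_ge0].
have hE : has_inf E.
  split; first by exists (N [:: 0%N]); exists [:: 0%N].
  by exists 0 => _ [X _ ->].
have e4 : 0 < e / 4 by rewrite divr_gt0.
have [_ [X X0 ->] hX] := inf_adherent e4 hE.
exists X => // h.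
set A := avgz X Z; set B := avgz X _.
have bA : bnd A by exact: bnd_avgz.
have bB : bnd B by exact: bnd_avgz.
have MB : M (fun w => B w ^+ 2) = N X.
  rewrite /N !mean_sq_avgzE// /avgz; congr (_ * _); apply: eq_bigr => y _.
  by congr (_ * _); apply: eq_bigr => x _; exact: Zinv.
(* The average over the concatenation is [(A + B) / 2]; its squared norm is at least [inf E], so the
   parallelogram law bounds that of [A - B] by [4 * (N X - inf E)]. *)
have : inf E <= N (X ++ [seq (x + h)%N | x <- X]).
  apply: ge_inf; first by case: hE.
  by exists (X ++ [seq (x + h)%N | x <- X]) => //; rewrite size_cat addn_gt0 X0.
have -> : N (X ++ [seq (x + h)%N | x <- X]) = M (fun w => 4^-1 * (A w + B w) ^+ 2).
  apply: eq_mean => w; rewrite /avgz size_cat size_map big_cat big_map /=.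
  rewrite /A /B /avgz natrD; have : (size X)%:R != 0 :> R by rewrite pnatr_eq0 -lt0n.
  by move=> ?; field; lra.
rewrite (meanZ hM); last by bd.
have -> : M (fun w => (A w - B w) ^+ 2) =
    2 * N X + 2 * N X - M (fun w => (A w + B w) ^+ 2).
  rewrite -{2}MB /N -!(meanZ hM) -?(meanD hM) -?(meanB hM); try bd.
  by apply: eq_mean => w; rewrite /A; ring.
by move: hX; lra.
Qed.

End Ergodic.

(** * Ultrafilter limits *)

Section UltraMean.
Context {R : realType}.

(** The image ultrafilter contains the compact segment [[-B, B]], so it has a limit there. *)
Lemma ulim_cvg (p : set_system nat) (a : nat -> R) :
  UltraFilter p -> bnd a -> a @ p --> ulim p a.
Proof.
move=> pU [B hB].
have aU : UltraFilter (a @ p).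
  split; first exact: fmap_proper_filter.
  move=> G GF sub; apply/seteqP; split; last exact: sub.
  move=> A GA; have [//|nA] := in_ultra_setVsetC (a @^-1` A) pU.
  have : G (~` A) by apply: sub; exact: nA.
  move=> GnA; have [G0 [_ GI _]] := GF.
  by case: G0; rewrite -(setICr A); exact: GI.
have := @segment_compact R (- B) B; rewrite compact_ultra => /(_ _ aU)[|l [_ al]].
  by apply: (@filterS _ p _ setT) => [x _|]; [rewrite /= in_itv/= -ler_norml|exact: filterT].
have : cvg (a @ p) by apply/cvg_ex; exists l.
by [].
Qed.

Lemma ulim_eq (p : set_system nat) (a : nat -> R) l :
  ProperFilter p -> a @ p --> l -> ulim p a = l.
Proof. by move=> pP al; apply: cvg_lim. Qed.

Lemma is_mean_ulim (p : set_system nat) : UltraFilter p -> is_mean (ulim (R := R) p).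
Proof.
move=> pU; have pP := @ultra_proper _ _ pU; split.
- by move=> F G bF bG; apply: ulim_eq; apply: cvgD; apply: ulim_cvg.
- by move=> c F bF; apply: ulim_eq; apply: cvgMl_tmp; apply: ulim_cvg.
- move=> F bF F0; apply: (@limr_ge _ p pP); first by apply/cvg_ex; exists (ulim p F); exact: ulim_cvg.
  exact: nearW.
- by apply: ulim_eq; apply: cvg_cst.
Qed.

Lemma ulim_near (p : set_system nat) (a : nat -> R) e : UltraFilter p -> bnd a ->
  0 < e -> p [set x | `|a x - ulim p a| < e].
Proof.
move=> pU ba e0; have := ulim_cvg pU ba.
move=> /cvgrPdist_lt /(_ _ e0); apply: filterS => x /=.
by rewrite distrC.
Qed.

Lemma ulim_le (p : set_system nat) (a b : nat -> R) : UltraFilter p -> bnd a -> bnd b ->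
  p [set x | a x <= b x] -> ulim p a <= ulim p b.
Proof.
move=> pU ba bb pab; have pP := @ultra_proper _ _ pU.
apply: ler_lim => //; apply/cvg_ex.
- by exists (ulim p a); exact: ulim_cvg.
- by exists (ulim p b); exact: ulim_cvg.
Qed.

Lemma ulim_ge (p : set_system nat) (a : nat -> R) c : UltraFilter p -> bnd a ->
  p [set x | c <= a x] -> c <= ulim p a.
Proof.
move=> pU ba pc; rewrite -(mean_cst (is_mean_ulim pU) c).
by apply: ulim_le => //; exact: bnd_cst.
Qed.

Lemma ulim_cvgn (p : set_system nat) (a : nat -> R) (l : R) : UltraFilter p -> \oo `<=` p ->
  a @ \oo --> l -> ulim p a = l.
Proof.
move=> pU pinf al; have pP := @ultra_proper _ _ pU; apply: ulim_eq.
by apply: cvg_trans al => A; exact: pinf.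
Qed.

Lemma ex_free_ultra : exists2 p : set_system nat, UltraFilter p & \oo `<=` p.
Proof. by have [p [pU pinf]] := ultraFilterLemma (@eventually_filter); exists p. Qed.

Lemma free_ultra_ex (p : set_system nat) (A : set nat) n : UltraFilter p -> \oo `<=` p ->
  p A -> exists2 k, (n < k)%N & A k.
Proof.
move=> pU pinf pA.
have pn : p [set k | (n < k)%N] by apply: pinf; exact: nbhs_infty_gt.
by have [k [Ak nk]] := filter_ex (filterI pA pn); exists k.
Qed.

(** Finitely many conditions hold together on a set of [p]. The [j]-th index is taken where the
    sequences of code at most [j] are within [1 / (j + 1)] of their limits, so one subsequence
    serves all. *)
Lemma diagonal_extraction (I : countType) (p : set_system nat) (x : I -> nat -> R) :
  UltraFilter p -> \oo `<=` p -> (forall i, bnd (x i)) ->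
  exists2 s : nat -> nat, (forall k, (s k < s k.+1)%N) &
    forall i, (x i \o s) @ \oo --> ulim p (x i).
Proof.
move=> pU pinf bx; have pP := @ultra_proper _ _ pU.
pose ok (j n : nat) := forall i : I, (choice.pickle i <= j)%N -> `|x i n - ulim p (x i)| < j.+1%:R^-1.
have pok j : p (ok j).
  have e0 : 0 < j.+1%:R^-1 :> R by rewrite invr_gt0.
  suff /(_ j.+1) : forall m, p [set n | forall i : I, (choice.pickle i < m)%N ->
      `|x i n - ulim p (x i)| < j.+1%:R^-1] by apply: filterS.
  elim=> [|m ih]; first by apply: filterS filterT.
  have [[i im]|nk] := pselect (exists i : I, choice.pickle i = m).
    apply: filterS (filterI ih (ulim_near pU (bx i) e0)) => n [h1 h2] i'.
    rewrite ltnS leq_eqVlt => /predU1P[i'm|]; last exact: h1.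
    by have -> : i' = i by apply: (pcan_inj choice.pickleK); rewrite i'm.
  apply: filterS ih => n h1 i; rewrite ltnS leq_eqVlt => /predU1P[im|]; last exact: h1.
  by exfalso; apply: nk; exists i.
have /choice[g hg] : forall jb : nat * nat, exists k, (jb.2 < k)%N /\ ok jb.1 k.
  by move=> [j b]; have [k bk okk] := free_ultra_ex b pU pinf (pok j); exists k.
pose s := fix s j := if j is j'.+1 then g (j, s j') else g (0, 0)%N.
have oks j : ok j (s j) by case: j => [|j]; [case: (hg (0, 0)%N)|case: (hg (j.+1, s j))].
exists s => [k|i]; first by case: (hg (k.+1, s k)).
apply/cvgrPdist_lt => e e0; near=> j.
rewrite /= distrC (lt_trans (oks j i _))//.
  by near: j; exact: nbhs_infty_ge.
by near: j; exact: near_infty_natSinv_lt (PosNum e0).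
Unshelve. all: by end_near. Qed.

Lemma ltn_mono_ge (s : nat -> nat) : (forall k, (s k < s k.+1)%N) -> forall k, (k <= s k)%N.
Proof. by move=> hs; elim=> // k ih; exact: leq_ltn_trans ih (hs k). Qed.

Lemma cvg_subseq (s : nat -> nat) (a : nat -> R) (l : R) : (forall k, (s k < s k.+1)%N) ->
  a @ \oo --> l -> (a \o s) @ \oo --> l.
Proof.
move=> hs al; apply: (@cvg_comp _ _ _ s a _ _ _ _ al) => A [n _ nA]; exists n => // k /= nk.
by apply: nA => /=; exact: leq_trans nk (ltn_mono_ge hs k).
Qed.

End UltraMean.

(** * Folner means *)

Section FolnerMean.
Context {R : realType}.

Definition fmean (p : set_system nat) (Phi : nat -> {fset nat}) (a : nat -> R) : R :=
  ulim p (avg Phi (fun=> 1) a).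

Lemma avg_normB (Phi : nat -> {fset nat}) (a : nat -> R) (B : R) N :
  (forall n, `|a n| <= B) -> `|avg Phi (fun=> 1) a N| <= B.
Proof.
move=> aB; have B0 : 0 <= B by rewrite (le_trans _ (aB 0%N)).
have [e0|n0] := eqVneq (#|` Phi N|%:R : R) 0; first by rewrite /avg e0 invr0 mul0r normr0.
rewrite /avg normrM ger0_norm ?invr_ge0// ler_pdivrMl ?lt0r ?n0//=.
rewrite (le_trans (ler_norm_sum _ _ _))//.
rewrite (@le_trans _ _ (\sum_(n <- Phi N) B))//.
  by apply: ler_sum => n _; rewrite mul1r.
by rewrite big_const_seq count_predT iter_addr_0 mulr_natl.
Qed.

Lemma bnd_avg Phi (a : nat -> R) : bnd a -> bnd (avg Phi (fun=> 1) a).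
Proof. by move=> [B aB]; exists B => N; exact: avg_normB. Qed.

Lemma avgD Phi (a b : nat -> R) N : avg Phi (fun=> 1) (fun n => a n + b n) N =
  avg Phi (fun=> 1) a N + avg Phi (fun=> 1) b N.
Proof. by rewrite /avg -mulrDr -big_split; congr (_ * _); apply: eq_bigr => n _; rewrite mulrDr. Qed.

Lemma avgZ Phi c (a : nat -> R) N : avg Phi (fun=> 1) (fun n => c * a n) N =
  c * avg Phi (fun=> 1) a N.
Proof. by rewrite /avg [RHS]mulrCA [X in _ = _ * X]mulr_sumr; congr (_ * _); apply: eq_bigr => n _; ring. Qed.

(** Shifting the argument is summing over the shifted set. The two sums then differ by terms over
    the two halves of the symmetric difference, each bounded through the whole of it, whence the
    factor 2. *)
Lemma avg_sub_shift (A : {fset nat}) (a : nat -> R) (B : R) m : (forall n, `|a n| <= B) ->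
  `|\sum_(n <- A) a (n + m)%N - \sum_(n <- A) a n| <= 2 * B * #|` fsymdiff (fshift A m) A|%:R.
Proof.
move=> aB; have B0 : 0 <= B by rewrite (le_trans _ (aB 0%N)).
have -> : \sum_(n <- A) a (n + m)%N = \sum_(n <- fshift A m) a n.
  by rewrite /fshift big_imfset//= => x y _ _ /addIn.
set S := fshift A m.
rewrite (bigID (fun n => n \in A)) /= [X in _ - X](bigID (fun n => n \in S)) /=.
have -> : \sum_(n <- S | n \in A) a n = \sum_(n <- A | n \in S) a n.
  rewrite -big_filter -[RHS]big_filter; apply: perm_big; apply: uniq_perm.
  - by rewrite filter_uniq.
  - by rewrite filter_uniq.
  - by move=> n; rewrite !mem_filter andbC.
have key (P Q : {fset nat}) : {subset (P `\` Q)%fset <= fsymdiff S A} ->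
    `|\sum_(n <- P | n \notin Q) a n| <= B * #|` fsymdiff S A|%:R.
  move=> sub; rewrite -big_filter (le_trans (ler_norm_sum _ _ _))//.
  rewrite (@le_trans _ _ (\sum_(n <- [seq n <- P | n \notin Q]) B))//.
    by apply: ler_sum => n _.
  rewrite big_const_seq count_predT iter_addr_0 -[B *+ _]mulr_natr ler_wpM2l// ler_nat.
  apply: uniq_leq_size; first by rewrite filter_uniq.
  by move=> n; rewrite mem_filter => /andP[nQ nP]; apply: sub; rewrite in_fsetD nQ.
rewrite opprD addrACA subrr add0r (le_trans (ler_normB _ _))//.
have -> : 2 * B * #|` fsymdiff S A|%:R = B * #|` fsymdiff S A|%:R + B * #|` fsymdiff S A|%:R by ring.
by apply: lerD; apply: key => n nD; rewrite in_fsetU nD ?orbT.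
Qed.

Lemma Folner_subseq (Phi : nat -> {fset nat}) (s : nat -> nat) :
  (forall k, (s k < s k.+1)%N) -> Folner (R := R) Phi -> Folner (R := R) (Phi \o s).
Proof.
by move=> hs [P0 Pi]; split=> [N|m m0]; [exact: P0|exact: cvg_subseq hs (Pi m m0)].
Qed.

Context {p : set_system nat} (pU : UltraFilter p) (pinf : \oo `<=` p).
Context {Phi : nat -> {fset nat}} (FPhi : Folner (R := R) Phi).

Lemma is_mean_fmean : is_mean (fmean p Phi).
Proof.
have hp := is_mean_ulim (R := R) pU.
split.
- move=> F G bF bG; rewrite /fmean -(meanD hp); try exact: bnd_avg.
  by apply: eq_mean => N; rewrite avgD.
- move=> c F bF; rewrite /fmean -(meanZ hp); last exact: bnd_avg.
  by apply: eq_mean => N; rewrite avgZ.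
- move=> F bF F0; apply: (mean_ge0 hp); first exact: bnd_avg.
  by move=> N; rewrite mulr_ge0 ?invr_ge0// sumr_ge0// => n _; rewrite mul1r.
- rewrite /fmean -[RHS](mean1 hp); apply: eq_mean => N.
  rewrite /avg mulr1 big_const_seq count_predT iter_addr_0 mulVf//.
  by rewrite pnatr_eq0 cardfs_eq0; case: FPhi.
Qed.

Lemma fmean_shift m a : bnd a -> fmean p Phi (fun n => a (n + m)%N) = fmean p Phi a.
Proof.
have hp := is_mean_ulim (R := R) pU.
(* [Folner] concerns positive shifts, so the zero shift is treated apart. *)
case: m => [|m] ba; first by apply: eq_mean => n; rewrite addn0.
have [B B0 aB] := bnd_pos ba.
apply/eqP; rewrite -subr_eq0; apply/eqP.
rewrite /fmean -(meanB hp); try by apply: bnd_avg; bd.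
apply: ulim_cvgn => //.
set D := (X in X @ \oo --> _).
apply/cvgrPdist_lt => e e0.
have := (FPhi.2 m.+1 isT).
move=> /cvgrPdist_lt /(_ (e / (2 * B))); rewrite divr_gt0 ?mulr_gt0// => /(_ isT).
apply: filterS => N; rewrite !sub0r !normrN.
set q := (_ / _ : R) => hq.
have q0 : 0 <= q by rewrite /q divr_ge0.
rewrite ger0_norm// ltr_pdivlMr ?mulr_gt0// in hq.
apply: le_lt_trans hq; rewrite /D /avg -mulrBr normrM ger0_norm ?invr_ge0//.
rewrite /q mulrAC [_^-1 * _]mulrC ler_wpM2r ?invr_ge0//.
rewrite [X in _ <= X]mulrC; apply: le_trans (avg_sub_shift _ m.+1 aB).
by rewrite le_eqVlt; apply/orP; left; apply/eqP; congr (`|_ - _|); apply: eq_bigr => n _; rewrite mul1r.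
Qed.

Lemma fmean_cvgn a l : avg Phi (fun=> 1) a @ \oo --> l -> fmean p Phi a = l.
Proof. exact: ulim_cvgn. Qed.

End FolnerMean.

(** * Structured and weakly mixing parts *)

Section Decomposition.
Context {R : realType} {M : (nat -> R) -> R} (hM : is_mean M).
Hypothesis M_shift : forall m a, bnd a -> M (fun n => a (n + m)%N) = M a.

Lemma mean_sqM_le {T : Type} {N : (T -> R) -> R} (hN : is_mean N) F G a b :
  bnd F -> bnd G -> 0 <= a -> 0 <= b ->
  N (fun x => F x ^+ 2) <= a ^+ 2 -> N (fun x => G x ^+ 2) <= b ^+ 2 ->
  `|N (fun x => F x * G x)| <= a * b.
Proof.
move=> bF bG a0 b0 Fa Gb.
rewrite -ler_sqr ?nnegrE ?mulr_ge0// real_normK ?num_real//.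
rewrite (le_trans (mean_CS hN bF bG))// exprMn; apply: ler_pM => //.
- by apply: (mean_ge0 hN) => [|x]; [bd|exact: sqr_ge0].
- by apply: (mean_ge0 hN) => [|x]; [bd|exact: sqr_ge0].
Qed.

(** Minkowski's inequality, in a form without square roots. *)
Lemma mean_sqD {T : Type} {N : (T -> R) -> R} (hN : is_mean N) F G a b :
  bnd F -> bnd G -> 0 <= a -> 0 <= b ->
  N (fun x => F x ^+ 2) <= a ^+ 2 -> N (fun x => G x ^+ 2) <= b ^+ 2 ->
  N (fun x => (F x + G x) ^+ 2) <= (a + b) ^+ 2.
Proof.
move=> bF bG a0 b0 Fa Gb.
have F0 : 0 <= N (fun x => F x ^+ 2) by apply: (mean_ge0 hN) => [|x]; [bd|exact: sqr_ge0].
have G0 : 0 <= N (fun x => G x ^+ 2) by apply: (mean_ge0 hN) => [|x]; [bd|exact: sqr_ge0].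
have FG : N (fun x => F x * G x) <= a * b.
  by rewrite (le_trans (ler_norm _))//; exact: mean_sqM_le.
have -> : N (fun x => (F x + G x) ^+ 2) =
    N (fun x => F x ^+ 2) + 2 * N (fun x => F x * G x) + N (fun x => G x ^+ 2).
  rewrite -(meanZ hN); last bd.
  rewrite -!(meanD hN); try bd.
  by apply: eq_mean => x; ring.
nra.
Qed.

Lemma mean_sqZ {T : Type} {N : (T -> R) -> R} (hN : is_mean N) F c :
  bnd F -> N (fun x => (c * F x) ^+ 2) = c ^+ 2 * N (fun x => F x ^+ 2).
Proof. by move=> bF; rewrite -(meanZ hN); [apply: eq_mean => x; ring|bd]. Qed.

Lemma mean_sq_avgz {T : Type} {N : (T -> R) -> R} (hN : is_mean N) X (F : nat -> T -> R) a :
  (forall x, bnd (F x)) -> 0 <= a -> (forall x, x \in X -> N (fun w => F x w ^+ 2) <= a ^+ 2) ->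
  N (fun w => avgz X F w ^+ 2) <= a ^+ 2.
Proof.
move=> bF a0 Fa.
have : N (fun w => (\sum_(x <- X) F x w) ^+ 2) <= ((size X)%:R * a) ^+ 2.
  elim: X Fa => [|x X ih] Fa.
    rewrite mul0r expr0n /= -[X in _ <= X](mean_cst hN 0).
    by rewrite (eq_mean (G := fun=> 0))// => w; rewrite big_nil expr0n.
  rewrite (eq_mean (G := fun w => (F x w + \sum_(x <- X) F x w) ^+ 2)); last first.
    by move=> w; rewrite big_cons.
  rewrite /= -natr1 addrC mulrDl mul1r.
  apply: mean_sqD => //; try bd; first by rewrite mulr_ge0.
    by apply: Fa; rewrite mem_head.
  by apply: ih => y yX; apply: Fa; rewrite in_cons yX orbT.
rewrite /avgz mean_sqZ//; last bd.
case: (posnP (size X)) => [->|X0] h; first by rewrite invr0 expr0n /= mul0r sqr_ge0.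
rewrite exprVn ler_pdivrMl ?exprn_gt0 ?ltr0n//.
by rewrite exprMn in h.
Qed.

(** Total boundedness, at scale [e], of the orbit of [u] in the quadratic seminorm. With colours, a
    sum needs only the product of two colourings, and an ultrafilter selects a single class. *)
Definition cpt (e : R) (u : nat -> R) := exists (T : finType) (col : nat -> T),
  forall h h', col h = col h' -> M (fun n => (u (n + h)%N - u (n + h')%N) ^+ 2) <= e ^+ 2.

Lemma cptD a b u v : bnd u -> bnd v -> 0 <= a -> 0 <= b -> cpt a u -> cpt b v ->
  cpt (a + b) (fun n => u n + v n).
Proof.
move=> bu bv a0 b0 [T [c hc]] [U [d hd]].
exists (T * U)%type, (fun n => (c n, d n)) => h h' [ch dh].
have := mean_sqD hM _ _ a0 b0 (hc _ _ ch) (hd _ _ dh).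
rewrite (eq_mean (G := fun n => (u (n + h)%N + v (n + h)%N - (u (n + h')%N + v (n + h')%N)) ^+ 2)).
  by apply; bd.
by move=> n; ring.
Qed.

Lemma cptZ a u c : bnd u -> cpt a u -> cpt (c * a) (fun n => c * u n).
Proof.
move=> bu [T [d hd]]; exists T, d => h h' dh.
rewrite (eq_mean (G := fun n => (c * (u (n + h)%N - u (n + h')%N)) ^+ 2)); last first.
  by move=> n; ring.
rewrite mean_sqZ//; last bd.
by rewrite exprMn ler_wpM2l ?sqr_ge0//; exact: hd.
Qed.

Lemma cpt_le a b u : 0 <= a -> a <= b -> cpt a u -> cpt b u.
Proof.
move=> a0 ab [T [d hd]]; exists T, d => h h' dh.
by rewrite (le_trans (hd _ _ dh))// lerXn2r// nnegrE (le_trans a0).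
Qed.

Lemma cpt0 e : cpt e (fun=> 0).
Proof.
exists unit, (fun=> tt) => h h' _.
rewrite (eq_mean (G := fun=> 0)) ?(mean_cst hM) ?sqr_ge0// => n.
by rewrite subrr expr0n.
Qed.

Lemma bucketing (B d : R) : 0 < d -> exists (T : finType) (c : R -> T), forall x y,
  `|x| <= B -> `|y| <= B -> c x = c y -> `|x - y| <= d.
Proof.
move=> d0; pose N := Num.truncn (2 * B / d).
exists 'I_N.+1, (fun x => inord (Num.truncn ((x + B) / d))) => x y xB yB.
have B0 : 0 <= B by rewrite (le_trans _ xB).
have key z : `|z| <= B -> [/\ 0 <= (z + B) / d, (Num.truncn ((z + B) / d) < N.+1)%N &
    (Num.truncn ((z + B) / d))%:R <= (z + B) / d < (Num.truncn ((z + B) / d)).+1%:R].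
  rewrite ler_norml => /andP[zl zr].
  have z0 : 0 <= (z + B) / d by apply: divr_ge0; lra.
  split => //; last exact: truncn_itv.
  by rewrite ltnS; apply: le_truncn; rewrite ler_pM2r ?invr_gt0//; lra.
have [_ xN xi] := key x xB; have [_ yN yi] := key y yB.
move=> /(congr1 val); rewrite /= !inordK// => exy; rewrite exy in xi.
have : `|(x + B) / d - (y + B) / d| <= 1.
  move: xi yi; rewrite -natr1 => /andP[x1 x2] /andP[y1 y2].
  by rewrite ler_norml; apply/andP; split; lra.
have -> : (x + B) / d - (y + B) / d = (x - y) / d by field; lra.
by rewrite normrM normfV (gtr0_norm d0) ler_pdivrMr// mul1r.
Qed.

Lemma bucketing_seq (X : seq nat) (b : nat -> nat -> R) (B d : R) : 0 < d ->
  (forall x h, `|b x h| <= B) -> exists (T : finType) (col : nat -> T),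
  forall h h', col h = col h' -> forall x, x \in X -> `|b x h - b x h'| <= d.
Proof.
move=> d0 hb; have [T [c hc]] := @bucketing B d d0.
elim: X => [|x X [U [col hcol]]]; first by exists unit, (fun=> tt).
exists (T * U)%type, (fun h => (c (b x h), col h)) => h h' [E1 E2] y.
by rewrite in_cons => /predU1P[->|yX]; [exact: hc|exact: hcol].
Qed.

Let corr (g : nat -> R) x y := M (fun n => g (n + x)%N * g (n + y)%N).

(** The squared norm of the average over [X] of the functions [g (n + x) * g (m + x)] of two
    variables, by [mean_sq_avgzE] for the product mean. Through [energy_null], a small value makes
    [g] almost weakly mixing. *)
Definition energy (N : (nat -> R) -> R) (g : nat -> R) (X : seq nat) : R :=
  avgz X (fun y _ => avgz X (fun x _ => N (fun n => g (n + x)%N * g (n + y)%N) ^+ 2) tt) tt.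

(* [w] is [L g] for [L = avg_x T^x g (x) T^x g]; if this tensor average is almost
   shift-invariant, then [L] almost commutes with the shift, and [T^h (L g)] is close to
   [L (T^h g)], which lives in a bounded part of the finite-dimensional range of [L]. *)
Lemma cpt_smoothing g (K e : R) : bnd g -> 0 < K -> M (fun n => g n ^+ 2) <= K ^+ 2 -> 0 < e ->
  exists X, let w := avgz X (fun x n => M (fun n => g (n + x)%N * g n) * g (n + x)%N) in
  [/\ (0 < size X)%N, cpt e w, M (fun n => w n ^+ 2) <= (K ^+ 3) ^+ 2 &
    energy M g X <= M (fun n => w n * g n) + e].
Proof.
move=> bg K0 gK e0.
pose Z x (p : nat * nat) := g (p.1 + x)%N * g (p.2 + x)%N.
have bZ x : bnd (Z x) by rewrite /Z; bd.
have hM2 := is_mean_prod hM hM.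
have corr_shift h x y : corr g (x + h) (y + h) = corr g x y.
  rewrite /corr -(M_shift h (a := fun n => g (n + x)%N * g (n + y)%N)); last bd.
  by apply: eq_mean => n; rewrite !addnA !(addnAC _ _ h).
have Zcorr x y : M (fun n => M (fun m => Z x (n, m) * Z y (n, m))) = corr g x y ^+ 2.
  rewrite expr2 /corr -(meanZr hM); last bd.
  apply: eq_mean => n; rewrite -(meanZ hM); last bd.
  by apply: eq_mean => m; rewrite /Z /=; ring.
(* The first bound serves the three-term triangle inequality for [cpt e w], the second the
   comparison of the energy with the correlation of [w] and [g]. *)
pose t := Num.min (e / (3 * K)) (e / K ^+ 2).
have t0 : 0 < t by rewrite lt_min !divr_gt0// ?mulr_gt0// exprn_gt0.
have tK : 3 * (t * K) <= e.
  have : t <= e / (3 * K) by rewrite ge_min lexx.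
  by rewrite ler_pdivlMr ?mulr_gt0//; lra.
have tK2 : t * K * K <= e.
  have : t <= e / K ^+ 2 by rewrite ge_min lexx orbT.
  by rewrite ler_pdivlMr ?exprn_gt0//; lra.
have [||X X0 hX] := ergodic_avg hM2 bZ _ (e := t ^+ 2); rewrite ?exprn_gt0//.
  by move=> h x y; rewrite !Zcorr corr_shift.
have gshift h : M (fun n => g (n + h)%N ^+ 2) <= K ^+ 2.
  by rewrite (M_shift h (a := fun n => g n ^+ 2))//; bd.
have bcorr x y : `|corr g x y| <= K ^+ 2.
  by rewrite expr2; apply: (mean_sqM_le hM) => //; try bd; exact: ltW.
have bcorr1 x : `|M (fun n => g (n + x)%N * g n)| <= K ^+ 2.
  have := bcorr x 0%N; rewrite /corr; apply: le_trans.
  rewrite (eq_mean (G := fun n => g (n + x)%N * g n))// => n.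
  by rewrite addn0.
exists X => w.
(* [L h] is the operator applied to [T^h g]; only its finitely many coefficients depend on [h]. *)
pose L h : nat -> R := avgz X (fun x n => corr g x h * g (n + x)%N).
have bL h : bnd (L h) by apply: bnd_avgz => x; bd.
have bw : bnd w by apply: bnd_avgz => x; bd.
have wL h : M (fun n => (w (n + h)%N - L h n) ^+ 2) <= (t * K) ^+ 2.
  (* [T^h w] and [L h] both integrate a kernel against [T^h g]; [D] is the difference of the two
     kernels, of norm at most [t]. *)
  pose D (p : nat * nat) := avgz X (fun x => Z (x + h)%N) p - avgz X Z p.
  have bD : bnd D by apply: bndD; [apply: bnd_avgz|apply: bndN; apply: bnd_avgz].
  have bDn n : bnd (fun m => D (n, m)) by case: bD => B hB; exists B.
  have -> : M (fun n => (w (n + h)%N - L h n) ^+ 2) =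
      M (fun n => M (fun m => D (n, m) * g (m + h)%N) ^+ 2).
    apply: eq_mean => n; congr (_ ^+ 2).
    rewrite /D (eq_mean (G := fun m =>
        (size X)%:R^-1 * \sum_(x <- X) (Z (x + h)%N (n, m) * g (m + h)%N) -
        (size X)%:R^-1 * \sum_(x <- X) (Z x (n, m) * g (m + h)%N))); last first.
      by move=> m; rewrite /avgz mulrBl -!mulrA -!mulr_suml.
    have bZh x k : bnd (fun m => Z x (n, m) * g (m + k)%N) by rewrite /Z /=; bd.
    rewrite (meanB hM) ?(meanZ hM) ?(mean_sum hM); try (by move=> ?; exact: bZh); try by bd.
    rewrite /w /L /avgz; congr (_ * _ - _ * _); apply: eq_bigr => x _.
      rewrite -[M (fun n => g (n + x)%N * g n)](M_shift h); last bd.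
      rewrite -(meanZr hM); last bd.
      by apply: eq_mean => m; rewrite /Z /= !addnA !(addnAC _ h x); ring.
    rewrite /corr -(meanZr hM); last bd.
    by apply: eq_mean => m; rewrite /Z /=; ring.
  apply: (@le_trans _ _ (M (fun n => M (fun m => D (n, m) ^+ 2) * K ^+ 2))).
    apply: (le_mean hM).
    - apply: bndX; apply: (bnd_mean hM); case: (bnd_comp (fun p : nat * nat => (p.2 + h)%N) bg) => A hA.
      by case: bD => B hB; exists (B * A) => -[n m]; rewrite normrM ler_pM// (hA (n, m)).
    - apply: bndM; last bd.
      by apply: (bnd_mean hM); case: (bndX 2 bD) => B hB; exists B => -[n m]; exact: (hB (n, m)).
    - move=> n; rewrite (le_trans (mean_CS hM _ _))//; try bd.
      rewrite ler_wpM2l//; apply: (mean_ge0 hM) => [|m]; [bd|exact: sqr_ge0].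
  rewrite (meanZr hM); last first.
    by apply: (bnd_mean hM); case: (bndX 2 bD) => B hB; exists B => -[n m]; exact: (hB (n, m)).
  rewrite exprMn ler_wpM2r ?sqr_ge0//.
  apply: le_trans (hX h); rewrite le_eqVlt; apply/orP; left; apply/eqP.
  by apply: eq_mean => n; apply: eq_mean => m; rewrite /D -sqrrN opprB.
split => //.
(* Equal rounded coefficients bring [L h] within [t * K] of [L h'], hence [T^h w] within [3 * t * K]
   of [T^h' w]. *)
- have [T [col hcol]] := bucketing_seq X t0 bcorr.
  exists T, col => h h' hh'.
  have LL : M (fun n => (L h n - L h' n) ^+ 2) <= (t * K) ^+ 2.
    rewrite (eq_mean (G := fun n =>
        avgz X (fun x n => (corr g x h - corr g x h') * g (n + x)%N) n ^+ 2)); last first.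
      move=> n; rewrite /L /avgz -mulrBr -sumrB; congr ((_ * _) ^+ 2).
      by apply: eq_bigr => x _; rewrite mulrBl.
    apply: (mean_sq_avgz hM); [by move=> x; bd|by rewrite mulr_ge0// ltW|].
    move=> x xX; rewrite (mean_sqZ hM); last bd.
    rewrite exprMn ler_pM ?sqr_ge0//.
      by apply: (mean_ge0 hM) => [|n]; [bd|exact: sqr_ge0].
    by rewrite -[X in X <= _]real_normK ?num_real// lerXn2r ?nnegrE ?(ltW t0)// hcol.
  have t1 : 0 <= t * K by rewrite mulr_ge0// ltW.
  have wL' : M (fun n => (L h' n - w (n + h')%N) ^+ 2) <= (t * K) ^+ 2.
    by rewrite (eq_mean (G := fun n => (w (n + h')%N - L h' n) ^+ 2))// => n; rewrite -sqrrN opprB.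
  have t2 : 0 <= t * K + t * K by rewrite addr_ge0.
  have S1 : M (fun n => ((w (n + h)%N - L h n) + (L h n - L h' n)) ^+ 2) <= (t * K + t * K) ^+ 2.
    by apply: (mean_sqD hM) => //; bd.
  have : M (fun n => (((w (n + h)%N - L h n) + (L h n - L h' n)) + (L h' n - w (n + h')%N)) ^+ 2)
      <= (t * K + t * K + t * K) ^+ 2.
    by apply: (mean_sqD hM) => //; bd.
  rewrite (eq_mean (G := fun n => (w (n + h)%N - w (n + h')%N) ^+ 2)) => [h1|n]; last by ring.
  by apply: le_trans h1 _; rewrite lerXn2r ?nnegrE ?(ltW e0) ?addr_ge0//; lra.
- apply: (mean_sq_avgz hM); [by move=> x; bd|by rewrite exprn_ge0// ltW|].
  move=> x _; rewrite (mean_sqZ hM); last bd.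
  have -> : (K ^+ 3) ^+ 2 = (K ^+ 2) ^+ 2 * K ^+ 2 by ring.
  rewrite ler_pM ?sqr_ge0//.
    by apply: (mean_ge0 hM) => [|n]; [bd|exact: sqr_ge0].
  by rewrite -[X in X <= _]real_normK ?num_real// lerXn2r ?nnegrE// exprn_ge0// ltW.
(* The inner average is the correlation of [L y] with [T^y g], close to that of [T^y w] with
   [T^y g], which by invariance is free of [y]. *)
- have key y : avgz X (fun x _ => corr g x y ^+ 2) tt <= M (fun n => w n * g n) + e.
    have -> : avgz X (fun x _ => corr g x y ^+ 2) tt = M (fun n => L y n * g (n + y)%N).
      rewrite (eq_mean (G := fun n =>
          (size X)%:R^-1 * \sum_(x <- X) corr g x y * (g (n + x)%N * g (n + y)%N))); last first.
        move=> n; rewrite /L /avgz -mulrA mulr_suml; congr (_ * _).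
        by apply: eq_bigr => x _; rewrite mulrA.
      rewrite (meanZ hM) ?(mean_sum hM); try (by move=> ?; bd); try by bd.
      rewrite /avgz; congr (_ * _); apply: eq_bigr => x _.
      by rewrite (meanZ hM) ?expr2//; bd.
    have -> : M (fun n => w n * g n) = M (fun n => w (n + y)%N * g (n + y)%N).
      by rewrite (M_shift y (a := fun n => w n * g n))//; bd.
    rewrite -lerBlDl -(meanB hM); try bd.
    apply: le_trans (ler_norm _) _; apply: le_trans tK2.
    rewrite (eq_mean (G := fun n => (L y n - w (n + y)%N) * g (n + y)%N)); last by move=> n; ring.
    apply: (mean_sqM_le hM) => //; try bd; [by rewrite mulr_ge0// ltW|exact: ltW|].
    by rewrite (eq_mean (G := fun n => (w (n + y)%N - L y n) ^+ 2))// => n; rewrite -sqrrN opprB.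
  rewrite /energy [X in X <= _]/avgz ler_pdivrMl ?ltr0n// mulr_natl.
  rewrite -iter_addr_0 -(count_predT X) -big_const_seq.
  by apply: ler_sum => y _; exact: key.
Qed.

End Decomposition.

(** * The span of the shifts of a function and almost best approximation in it *)

Section ShiftSpan.
Context {R : realType}.

(** Second moments within the span reduce to the countably many correlations of two shifts of [f],
    so one extraction makes them genuine limits, which further subsequences preserve. *)
Inductive shift_span (f : nat -> R) : (nat -> R) -> Prop :=
| span_shift m : shift_span f (fun n => f (n + m)%N)
| span_lin a b u v : shift_span f u -> shift_span f v ->
    shift_span f (fun n => a * u n + b * v n).

Lemma span_ext f u v : shift_span f u -> (forall n, u n = v n) -> shift_span f v.
Proof. by move=> su /funext <-. Qed.

Lemma span_self f : shift_span f f.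
Proof. by apply: span_ext (span_shift f 0) _ => n; rewrite addn0. Qed.

Lemma span_bnd f u : bnd f -> shift_span f u -> bnd u.
Proof. by move=> bf; elim=> [m|a b v w _ bv _ bw]; bd. Qed.

Lemma span_shifted f u m : shift_span f u -> shift_span f (fun n => u (n + m)%N).
Proof.
elim=> [k|a b v w _ ihv _ ihw]; last exact: span_lin.
by apply: span_ext (span_shift f (m + k)) _ => n; rewrite addnA.
Qed.

Lemma span0 f : shift_span f (fun=> 0).
Proof. by apply: span_ext (span_lin 0 0 (span_self f) (span_self f)) _ => n; rewrite !mul0r addr0. Qed.

Lemma spanB f u v : shift_span f u -> shift_span f v -> shift_span f (fun n => u n - v n).
Proof. by move=> su sv; apply: span_ext (span_lin 1 (- 1) su sv) _ => n; ring. Qed.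

Lemma span_avgz f X (F : nat -> nat -> R) :
  (forall x, shift_span f (F x)) -> shift_span f (avgz X F).
Proof.
move=> sF; suff h : shift_span f (fun n => \sum_(x <- X) F x n).
  by apply: span_ext (span_lin (size X)%:R^-1 0 h h) _ => n; rewrite mul0r addr0.
elim: X => [|x X ih]; first by apply: span_ext (span0 f) _ => n; rewrite big_nil.
by apply: span_ext (span_lin 1 1 (sF x) ih) _ => n; rewrite big_cons !mul1r.
Qed.

Context {M : (nat -> R) -> R} (hM : is_mean M).
Hypothesis M_shift : forall m a, bnd a -> M (fun n => a (n + m)%N) = M a.

Let sq (u : nat -> R) := M (fun n => u n ^+ 2).

Let sq_par u v : bnd u -> bnd v -> sq (fun n => u n - v n) =
  2 * sq u + 2 * sq v - 4 * sq (fun n => 2^-1 * u n + 2^-1 * v n).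
Proof.
move=> bu bv; rewrite /sq -!(meanZ hM) -?(meanD hM) -?(meanB hM); try by bd.
by apply: eq_mean => n; field.
Qed.

(* [u] and [u'] are almost closest to [f] among the [cpt] elements of the span, so that
   [u - u'] is small by the parallelogram law, and [f - u'] is almost orthogonal to all
   [cpt] elements, in particular to [cpt_smoothing] of [f - u'] itself. *)
Lemma cpt_decomposition f (K e : R) : bnd f -> 1 <= K -> M (fun n => f n ^+ 2) <= K ^+ 2 -> 0 < e ->
  exists u, [/\ shift_span f u, cpt (M := M) e u, M (fun n => u n ^+ 2) <= (3 * K) ^+ 2 &
    forall d, 0 < d -> exists u' X, [/\ shift_span f u',
      M (fun n => (u n - u' n) ^+ 2) <= e ^+ 2,
      M (fun n => (f n - u' n) ^+ 2) <= (2 * K) ^+ 2,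
      (0 < size X)%N & energy M (fun n => f n - u' n) X <= d]].
Proof.
move=> bf K1 fK e0.
have K0 : 0 < K by lra.
pose q u := sq (fun n => f n - u n).
have bS u : shift_span f u -> bnd u by exact: span_bnd.
have q0 u : shift_span f u -> 0 <= q u.
  by move=> /bS bu; apply: (mean_ge0 hM) => [|n]; [bd|exact: sqr_ge0].
(* [sup E] is the limit, as [a] tends to 0, of the squared distance from [f] to the [cpt a] elements
   of the span: that distance can only grow as [a] decreases. *)
pose E := [set r : R | exists2 a, 0 < a & forall u, shift_span f u -> cpt (M := M) a u -> r <= q u].
have qz : q (fun=> 0) <= K ^+ 2.
  by apply: le_trans fK; rewrite /q /sq (eq_mean (G := fun n => f n ^+ 2))// => n; rewrite subr0.
have hE : has_sup E.
  split; first by exists 0, 1 => // u su _; exact: q0.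
  by exists (K ^+ 2) => r [a _ ha]; apply: le_trans qz; apply: ha; [exact: span0|exact: cpt0].
pose D := sup E.
have Dlow n : 0 < n -> exists2 a, 0 < a & forall u, shift_span f u -> cpt (M := M) a u -> D - n <= q u.
  move=> n0; have [r [a a0 ha] hr] := sup_adherent n0 hE.
  by exists a => // u su cu; rewrite (le_trans (ltW hr))//; exact: ha.
have Dup n a : 0 < n -> 0 < a -> exists u, [/\ shift_span f u, cpt (M := M) a u & q u <= D + n].
  move=> n0 a0; apply: contrapT => nu.
  have : D + n <= D.
    apply: (sup_upper_bound hE); exists a => // u su cu.
    by rewrite leNgt; apply/negP => /ltW qu; apply: nu; exists u.
  by lra.
have D0 : D <= K ^+ 2.
  apply: ge_sup; first by case: hE.
  by move=> r [a _ ha]; apply: le_trans qz; apply: ha; [exact: span0|exact: cpt0].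
have KK : 1 <= K ^+ 2 by rewrite exprn_ege1.
(* [eta <= 1] keeps [f - u] and [f - u'] of norm at most [2 * K]; [8 * eta] bounds the parallelogram
   defect of [u] and [u']. *)
pose eta := Num.min 1 (e ^+ 2 / 8).
have eta0 : 0 < eta by rewrite lt_min ltr01 divr_gt0// exprn_gt0.
have eta1 : eta <= 1 by rewrite ge_min lexx.
have eta8 : 8 * eta <= e ^+ 2.
  have : eta <= e ^+ 2 / 8 by rewrite ge_min lexx orbT.
  by lra.
have [e1 e1_0 he1] := Dlow _ eta0.
pose a := Num.min e e1.
have a0 : 0 < a by rewrite lt_min e0.
have [u [su cu qu]] := Dup _ _ eta0 a0.
have bu := bS _ su.
have bound v : shift_span f v -> q v <= D + 1 -> q v <= (2 * K) ^+ 2.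
  by move=> _ h; apply: le_trans h _; rewrite exprMn; lra.
exists u; split => //.
- by apply: cpt_le cu; [exact: ltW|rewrite ge_min lexx].
- have -> : 3 * K = K + 2 * K by ring.
  rewrite (eq_mean (G := fun n => (f n + (- (f n - u n))) ^+ 2)); last by move=> n; ring.
  apply: (mean_sqD hM) => //; try bd; [exact: ltW|by rewrite mulr_ge0// ltW|].
  rewrite (eq_mean (G := fun n => (f n - u n) ^+ 2)); last by move=> n; rewrite sqrrN.
  by apply: bound => //; lra.
move=> d d0.
pose C := ((2 * K) ^+ 3) ^+ 2.
have C0 : 0 < C by rewrite !exprn_gt0// mulr_gt0.
pose t := Num.min 1 (d / (2 * C)).
have t0 : 0 < t by rewrite lt_min ltr01 divr_gt0// mulr_gt0.
have t1 : t <= 1 by rewrite ge_min lexx.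
have tC : t * C <= d / 2.
  have : t <= d / (2 * C) by rewrite ge_min lexx orbT.
  by rewrite ler_pdivlMr ?mulr_gt0//; lra.
pose eta' := Num.min eta (t * d / 4).
have td0 : 0 < t * d by rewrite mulr_gt0.
have eta'0 : 0 < eta' by rewrite lt_min eta0; lra.
have eta'1 : eta' <= eta by rewrite ge_min lexx.
have eta'2 : eta' <= t * d / 4 by rewrite ge_min lexx orbT.
have [e2 e2_0 he2] := Dlow _ eta'0.
have e22 : 0 < e2 / 2 by rewrite divr_gt0.
(* [e1] serves the midpoint of [u] and [u'], [e2 / 2] the competitor [u' + t * w]. *)
pose a' := Num.min e1 (e2 / 2).
have a'0 : 0 < a' by rewrite lt_min e1_0.
have [u' [su' cu' qu']] := Dup _ _ eta'0 a'0.
have bu' := bS _ su'.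
have qu'' : q u' <= (2 * K) ^+ 2 by apply: bound => //; lra.
pose g n := f n - u' n.
have bg : bnd g by rewrite /g; bd.
have d2 : 0 < Num.min (e2 / 2) (d / 2) by rewrite lt_min e22 divr_gt0.
have [X] := cpt_smoothing hM M_shift bg (mulr_gt0 (ltr0Sn _ 1) K0) qu'' d2.
set w := avgz X _ => -[X0 cw sw hw].
exists u', X; split => //.
- apply: le_trans eta8; rewrite -/(sq _).
  have -> : sq (fun n => u n - u' n) = sq (fun n => (f n - u' n) - (f n - u n)).
    by rewrite /sq; apply: eq_mean => n; ring.
  rewrite sq_par; try bd.
  have : D - eta <= q (fun n => 2^-1 * u n + 2^-1 * u' n).
    apply: he1; first exact: span_lin.
    have h2 : 0 <= 2^-1 :> R by rewrite invr_ge0.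
    have -> : e1 = 2^-1 * e1 + 2^-1 * e1 by field.
    apply: (cptD hM); try bd; try by rewrite mulr_ge0// ltW.
      apply: (cptZ hM) => //; apply: cpt_le cu; first exact: ltW.
      by rewrite ge_min lexx orbT.
    apply: (cptZ hM) => //; apply: cpt_le cu'; first exact: ltW.
    by rewrite ge_min lexx.
  have -> : q (fun n => 2^-1 * u n + 2^-1 * u' n) =
      sq (fun n => 2^-1 * (f n - u' n) + 2^-1 * (f n - u n)).
    by rewrite /q /sq; apply: eq_mean => n; field.
  by move: qu qu'; rewrite /q; lra.
- apply: le_trans hw _.
  have bw : bnd w by apply: bnd_avgz => x; bd.
  have sg : shift_span f g by apply: spanB => //; exact: span_self.
  have sw' : shift_span f w.
    apply: span_avgz => x.
    apply: span_ext (span_lin (M (fun n => g (n + x)%N * g n)) 0 (span_shifted x sg) sg) _ => n.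
    by rewrite mul0r addr0.
  (* If the correlation of [w] with [g] exceeded [d / 2], then [u' + t * w] would be closer to [f]
     than [D] permits. *)
  have : D - eta' <= q (fun n => 1 * u' n + t * w n).
    apply: he2; first exact: span_lin.
    have -> : e2 = 1 * (e2 / 2) + t * (e2 / 2) + (1 - t) * (e2 / 2) by field.
    apply: (@cpt_le _ _ (1 * (e2 / 2) + t * (e2 / 2))).
    + by rewrite addr_ge0// mulr_ge0// ltW.
    + by rewrite lerDl mulr_ge0// ?(ltW e22)// subr_ge0.
    apply: (cptD hM); try bd; try by rewrite mulr_ge0// ltW.
      apply: (cptZ hM) => //; apply: cpt_le cu'; first exact: ltW.
      by rewrite ge_min lexx orbT.
    apply: (cptZ hM) => //; apply: cpt_le cw; first exact: ltW.
    by rewrite ge_min lexx.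
  have -> : q (fun n => 1 * u' n + t * w n) =
      q u' - 2 * t * M (fun n => w n * g n) + t ^+ 2 * sq w.
    rewrite /q /sq -!(meanZ hM) -?(meanB hM) -?(meanD hM); try by bd.
    by apply: eq_mean => n; rewrite /g; ring.
  have : t ^+ 2 * sq w <= t ^+ 2 * C by rewrite ler_wpM2l// sqr_ge0.
  have dm : Num.min (e2 / 2) (d / 2) <= d / 2 by rewrite ge_min lexx orbT.
  set m := M _; set s := sq w; set mm := Num.min _ _ in dm *; move=> h1 h2.
  have h3 : t * (2 * m) <= t * d.
    have : t ^+ 2 * C <= t * (d / 2) by rewrite expr2 -mulrA ler_wpM2l// ltW.
    by lra.
  by rewrite ler_pM2l// in h3; lra.
Qed.

End ShiftSpan.

(** * The autocorrelation kernel *)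

Section Kernel.
Context {R : realType} {M : (nat -> R) -> R} (hM : is_mean M).
Hypothesis M_shift : forall m a, bnd a -> M (fun n => a (n + m)%N) = M a.

Lemma mean_mul_shift (a b : nat -> R) h x y : bnd a -> bnd b ->
  M (fun n => a (n + (x + h))%N * b (n + (y + h))%N) = M (fun n => a (n + x)%N * b (n + y)%N).
Proof.
move=> ba bb; rewrite -(M_shift h (a := fun n => a (n + x)%N * b (n + y)%N)); last bd.
by apply: eq_mean => n; rewrite !addnA !(addnAC _ h).
Qed.

Lemma le_avgz X (F G : nat -> R) : (forall x, x \in X -> F x <= G x) ->
  avgz X (fun x _ => F x) tt <= avgz X (fun x _ => G x) tt.
Proof.
move=> FG; rewrite /avgz ler_wpM2l ?invr_ge0//.
by rewrite big_seq [X in _ <= X]big_seq; apply: ler_sum => x xX; exact: FG.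
Qed.

Lemma avgz_cst X (c : R) : (0 < size X)%N -> avgz X (fun _ _ => c) tt = c.
Proof.
move=> X0; rewrite /avgz big_const_seq count_predT iter_addr_0 -[c *+ _]mulr_natl mulKf//.
by rewrite pnatr_eq0 -lt0n.
Qed.

Lemma avgz_dist X (F : nat -> R) c e : (0 < size X)%N -> (forall x, `|F x - c| <= e) ->
  `|avgz X (fun x _ => F x) tt - c| <= e.
Proof.
move=> X0 Fc.
have h1 : c - e <= avgz X (fun x _ => F x) tt.
  rewrite -(avgz_cst (c - e) X0); apply: le_avgz => x _.
  by move: (Fc x); rewrite ler_norml => /andP[]; lra.
have h2 : avgz X (fun x _ => F x) tt <= c + e.
  rewrite -(avgz_cst (c + e) X0); apply: le_avgz => x _.
  by move: (Fc x); rewrite ler_norml => /andP[]; lra.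
by rewrite ler_norml; apply/andP; split; lra.
Qed.

(* [N] and [M] need not be the same mean: the bound holds pointwise in [m] after
   averaging over the finite set [X]. *)
Lemma energy_null {N : (nat -> R) -> R} (hN : is_mean N)
  (N_shift : forall m a, bnd a -> N (fun n => a (n + m)%N) = N a) g v X (V d : R) :
  bnd g -> bnd v -> 0 <= d -> N (fun n => v n ^+ 2) <= V ->
  (0 < size X)%N -> energy N g X <= d ^+ 2 ->
  M (fun m => N (fun n => g (n + m)%N * v n) ^+ 2) <= V * d.
Proof.
move=> bg bv d0 vV X0 hX.
have v0 : 0 <= N (fun n => v n ^+ 2) by apply: (mean_ge0 hN) => [|n]; [bd|exact: sqr_ge0].
have V0 : 0 <= V by exact: le_trans vV.
have hN2 := is_mean_prod hN hN.
pose a m := N (fun n => g (n + m)%N * v n).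
have ba : bnd a by apply: (bnd_mean hN); bd.
pose Q m := avgz X (fun x _ => a (m + x)%N ^+ 2) tt.
have QV m : Q m <= V * d.
  (* [Q m] is the correlation of the averaged kernel [W] with [v n * v n']; its Cauchy-Schwarz bound
     is free of [m], as the energy is shift-invariant. *)
  pose W x (p : nat * nat) := g (p.1 + (m + x))%N * g (p.2 + (m + x))%N.
  have bW x : bnd (W x) by rewrite /W; bd.
  have QE : Q m = N (fun n => N (fun n' => avgz X W (n, n') * (v n * v n'))).
    rewrite /Q /avgz.
    transitivity ((size X)%:R^-1 * \sum_(x <- X)
        N (fun n => N (fun n' => W x (n, n') * (v n * v n')))).
      congr (_ * _); apply: eq_bigr => x _; rewrite /a expr2 -(meanZr hN); last bd.
      apply: eq_mean => n; rewrite -(meanZ hN); last bd.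
      by apply: eq_mean => n'; rewrite /W /=; ring.
    rewrite -(mean_sum hN) => [|x]; last by bd.
    rewrite -(meanZ hN); last by bd.
    apply: eq_mean => n; rewrite -(mean_sum hN) => [|x]; last by bd.
    rewrite -(meanZ hN); last by bd.
    by apply: eq_mean => n'; rewrite -mulrA mulr_suml.
  have bF : bnd (avgz X W) by apply: bnd_avgz.
  have bvv : bnd (fun p : nat * nat => v p.1 * v p.2) by bd.
  apply: le_trans (ler_norm _) _.
  rewrite -ler_sqr ?nnegrE ?mulr_ge0// real_normK ?num_real// QE.
  apply: le_trans (mean_CS hN2 bF bvv) _.
  rewrite exprMn [X in _ <= X]mulrC; apply: ler_pM.
  - exact: (mean_ge0 hN2 (bndX 2 bF) (fun p => sqr_ge0 _)).
  - exact: (mean_ge0 hN2 (bndX 2 bvv) (fun p => sqr_ge0 _)).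
  - apply: le_trans hX; rewrite (mean_sq_avgzE hN2)// /energy /avgz.
    rewrite le_eqVlt; apply/orP; left; apply/eqP.
    congr (_ * _); apply: eq_bigr => y _; congr (_ * _); apply: eq_bigr => x _.
    have <- : N (fun n => g (n + (m + x))%N * g (n + (m + y))%N) =
        N (fun n => g (n + x)%N * g (n + y)%N).
      rewrite -(N_shift m (fun n => g (n + x)%N * g (n + y)%N)); last bd.
      by apply: eq_mean => n; rewrite !addnA.
    rewrite expr2 -(meanZr hN); last bd.
    apply: eq_mean => n; rewrite -(meanZ hN); last bd.
    by apply: eq_mean => n'; rewrite /W /=; ring.
  - apply: (@le_trans _ _ (N (fun n => v n ^+ 2) ^+ 2)); last by rewrite lerXn2r.
    rewrite le_eqVlt; apply/orP; left; apply/eqP.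
    rewrite [RHS]expr2 -(meanZr hN); last bd.
    apply: eq_mean => n; rewrite -(meanZ hN); last bd.
    by apply: eq_mean => n' /=; ring.
have <- : M Q = M (fun m => a m ^+ 2).
  rewrite /Q /avgz (meanZ hM); last bd.
  rewrite (mean_sum hM); last by move=> x; bd.
  rewrite (eq_bigr (fun=> M (fun m => a m ^+ 2))); last first.
    by move=> x _; rewrite (M_shift x (a := fun m => a m ^+ 2))//; bd.
  by have := avgz_cst (M (fun m => a m ^+ 2)) X0.
by apply: (mean_leB hM) => //; rewrite /Q /avgz; bd.
Qed.

Context {psi : nat -> R}.
Hypothesis psi1 : forall n, 0 <= psi n <= 1.

Definition kap x y := M (fun t => psi (t + x)%N * psi (t + y)%N).
Definition kapm := M (kap 0).

Lemma bnd_psi : bnd psi.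
Proof. by exists 1 => n; have /andP[p0 p1] := psi1 n; rewrite ger0_norm. Qed.
Let bpsi := bnd_psi.

Lemma kapC x y : kap x y = kap y x.
Proof. by apply: eq_mean => t; rewrite mulrC. Qed.

Lemma kap_shift h x y : kap (x + h) (y + h) = kap x y.
Proof. exact: mean_mul_shift. Qed.

Lemma kap_ge0 x y : 0 <= kap x y.
Proof.
apply: (mean_ge0 hM) => [|t]; first bd.
by rewrite mulr_ge0//; [case/andP: (psi1 (t + x)%N)|case/andP: (psi1 (t + y)%N)].
Qed.

Lemma kap_le1 x y : kap x y <= 1.
Proof.
apply: (mean_leB hM) => [|t]; first bd.
have /andP[a0 a1] := psi1 (t + x)%N; have /andP[b0 b1] := psi1 (t + y)%N.
by rewrite -[1]mulr1 ler_pM.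
Qed.

Lemma bnd_kap : bnd (fun p : nat * nat => kap p.1 p.2).
Proof. by exists 1 => p; rewrite ger0_norm ?kap_ge0// kap_le1. Qed.

Lemma bnd_kap1 x : bnd (kap x).
Proof. exact: bnd_curry bnd_kap. Qed.

Lemma mean_kap x : M (kap x) = kapm.
Proof.
rewrite -(M_shift x (bnd_kap1 x)); apply: eq_mean => l.
by rewrite -[in LHS](add0n x) kap_shift.
Qed.

(** By [ergodic_avg] the average [P] of the shifts of [psi] over [Y] is almost invariant, so the
    correlation of [T^l psi] with [P] hardly depends on [l] and stays near its mean [kapm].
    Averaging it over [l] in [Y] gives the squared norm of [P]. *)
Lemma kap_avg s : 0 < s -> exists Y, [/\ (0 < size Y)%N,
  forall l, `|avgz Y (fun y _ => kap l y) tt - kapm| <= s &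
  `|M (fun t => avgz Y (fun y t => psi (t + y)%N) t ^+ 2) - kapm| <= s].
Proof.
move=> s0; pose Z x t := psi (t + x)%N.
have bZ x : bnd (Z x) by rewrite /Z; bd.
have s2 : 0 < (s / 2) ^+ 2 by rewrite exprn_gt0// divr_gt0.
have [h x y|Y Y0 hY] := ergodic_avg hM bZ _ s2; first exact: kap_shift.
pose phi l := avgz Y (fun y _ => kap l y) tt.
have bP h : bnd (avgz Y (fun y => Z (y + h)%N)) by apply: bnd_avgz.
have phiE h l : phi l = M (fun t => Z (l + h)%N t * avgz Y (fun y => Z (y + h)%N) t).
  rewrite (eq_mean (G := fun t => (size Y)%:R^-1 * \sum_(y <- Y) Z (l + h)%N t * Z (y + h)%N t)).
    rewrite (meanZ hM) ?(mean_sum hM); try (by move=> ?; bd); try by bd.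
    by rewrite /phi /avgz; congr (_ * _); apply: eq_bigr => y _; rewrite -(kap_shift h).
  by move=> t; rewrite /avgz mulrCA mulr_sumr.
have phi0 l : `|phi l - phi 0%N| <= s / 2.
  have -> : phi l - phi 0%N =
      M (fun t => Z l t * (avgz Y Z t - avgz Y (fun y => Z (y + l)%N) t)).
    have bP0 : bnd (avgz Y Z) by apply: bnd_avgz.
    rewrite (eq_mean (G := fun t => Z l t * avgz Y Z t - Z l t * avgz Y (fun y => Z (y + l)%N) t)).
      rewrite (meanB hM); try bd.
      rewrite (phiE l 0%N) (phiE 0%N l) add0n; congr (_ - _); apply: eq_mean => t.
      by rewrite addn0 /avgz; congr (_ * (_ * _)); apply: eq_bigr => y _; rewrite addn0.
    by move=> t; rewrite mulrBr.
  rewrite -[s / 2]mul1r; apply: (mean_sqM_le hM) => //.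
  - by apply: bndD => //; [exact: bnd_avgz|apply: bndN].
  - by rewrite ltW// divr_gt0.
  - rewrite expr1n; apply: (mean_leB hM) => [|t]; first bd.
    by have /andP[p0 p1] := psi1 (t + l)%N; rewrite expr_le1.
have phim : `|phi 0%N - kapm| <= s / 2.
  have bk x : bnd (fun l => kap l x) by apply: bnd_comp2; exact: bnd_kap.
  have bphi : bnd phi by rewrite /phi /avgz; bd.
  have <- : M phi = kapm.
    rewrite /phi /avgz (meanZ hM) ?(mean_sum hM)//; last bd.
    rewrite (eq_bigr (fun=> kapm)); first exact: (avgz_cst kapm Y0).
    by move=> y _; rewrite -(mean_kap y); apply: eq_mean => l; exact: kapC.
  have -> : phi 0%N - M phi = M (fun l => - (phi l - phi 0%N)).
    by rewrite (meanN hM) ?(meanB hM) ?(mean_cst hM) ?opprB//; bd.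
  by apply: (mean_normB hM) => l; rewrite normrN.
have phil l : `|phi l - kapm| <= s.
  have -> : phi l - kapm = (phi l - phi 0%N) + (phi 0%N - kapm) by ring.
  rewrite (le_trans (ler_normD _ _))//; move: (phi0 l) phim; lra.
exists Y; split => //.
rewrite (mean_sq_avgzE hM) => [|y]; last bd.
apply: avgz_dist => // y; have := phil y; apply: le_trans.
rewrite le_eqVlt; apply/orP; left; apply/eqP; congr (`|_ - _|).
by rewrite /phi /avgz; congr (_ * _); apply: eq_bigr => x _; exact: kapC.
Qed.

(** Averages of shifts of [psi] have mean [M psi], and [kap_avg] brings their second moment as close
    to [kapm] as desired; a second moment is at least the squared mean. *)
Lemma kapm_ge : M psi ^+ 2 <= kapm.
Proof.
rewrite leNgt; apply/negP => lt.
have s0 : 0 < (M psi ^+ 2 - kapm) / 2 by rewrite divr_gt0// subr_gt0.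
have [Y [Y0 _]] := kap_avg s0.
have bP : bnd (avgz Y (fun y t => psi (t + y)%N)) by apply: bnd_avgz => y; bd.
have := mean_sqr_le hM bP.
have -> : M (avgz Y (fun y t => psi (t + y)%N)) = M psi.
  rewrite /avgz (meanZ hM) ?(mean_sum hM); try (by move=> ?; bd); try by bd.
  rewrite (eq_bigr (fun=> M psi)); last by move=> y _; rewrite (M_shift y (a := psi)).
  by have := avgz_cst (M psi) Y0.
by rewrite ler_norml => h /andP[h1 h2]; lra.
Qed.

(** With [P] from [kap_avg] in the part of the projection of [psi] to invariant functions,
    [kap - kapm] is almost the Gram kernel of the functions [T^x psi - P]. *)
Lemma kap_psd L (w : nat -> R) :
  0 <= \sum_(x <- L) \sum_(y <- L) w x * w y * (kap x y - kapm).
Proof.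
set S := \sum_(x <- L) _.
pose W := \sum_(x <- L) w x; pose A := \sum_(x <- L) `|w x|.
(* The error per unit of [s], from the cross term and from the norm of [P]. *)
pose C := 2 * `|W| * A + W ^+ 2.
have C0 : 0 <= C by rewrite addr_ge0 ?sqr_ge0// !mulr_ge0// sumr_ge0.
suff key s : 0 < s -> - (s * C) <= S.
  rewrite leNgt; apply/negP => S0.
  have := key (- S / (C + 1) / 2); rewrite !divr_gt0//; try lra.
  move=> /(_ isT); have : - S / (C + 1) / 2 * C <= - S / 2.
    rewrite mulrAC ler_pM2r// mulrAC ler_pdivrMr; nra.
  by lra.
move=> s0; have [Y [Y0 hY hP]] := kap_avg s0.
set P := avgz Y _ in hP.
have bP : bnd P by apply: bnd_avgz => y; bd.
pose F t := \sum_(x <- L) w x * psi (t + x)%N.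
have bF : bnd F by rewrite /F; bd.
have : 0 <= M (fun t => (F t - W * P t) ^+ 2).
  by apply: (mean_ge0 hM) => [|t]; [bd|exact: sqr_ge0].
have -> : M (fun t => (F t - W * P t) ^+ 2) =
    M (fun t => F t ^+ 2) - 2 * W * M (fun t => F t * P t) + W ^+ 2 * M (fun t => P t ^+ 2).
  rewrite -!(meanZ hM) -?(meanB hM) -?(meanD hM); try by bd.
  by apply: eq_mean => t; ring.
have -> : M (fun t => F t ^+ 2) = S + W ^+ 2 * kapm.
  have -> : M (fun t => F t ^+ 2) = \sum_(x <- L) \sum_(y <- L) w x * w y * kap x y.
    rewrite (eq_mean (G := fun t => \sum_(x <- L) \sum_(y <- L)
      w x * w y * (psi (t + x)%N * psi (t + y)%N))); last first.
      move=> t; rewrite expr2 /F mulr_suml; apply: eq_bigr => x _.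
      by rewrite mulr_sumr; apply: eq_bigr => y _; ring.
    rewrite (mean_sum hM); last by move=> x; bd.
    apply: eq_bigr => x _; rewrite (mean_sum hM); last by move=> y; bd.
    by apply: eq_bigr => y _; rewrite (meanZ hM)//; bd.
  have -> : W ^+ 2 * kapm = \sum_(x <- L) \sum_(y <- L) w x * w y * kapm.
    rewrite expr2 /W mulr_suml mulr_suml; apply: eq_bigr => x _.
    by rewrite mulr_sumr mulr_suml.
  rewrite /S -big_split; apply: eq_bigr => x _; rewrite -big_split; apply: eq_bigr => y _ /=.
  by ring.
have -> : M (fun t => F t * P t) = \sum_(x <- L) w x * avgz Y (fun y _ => kap x y) tt.
  rewrite (eq_mean (G := fun t => \sum_(x <- L) w x * ((size Y)%:R^-1 *
      \sum_(y <- Y) psi (t + x)%N * psi (t + y)%N))); last first.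
    move=> t; rewrite /F mulr_suml; apply: eq_bigr => x _.
    by rewrite -mulr_sumr /P /avgz; ring.
  rewrite (mean_sum hM); last by move=> x; bd.
  apply: eq_bigr => x _; rewrite !(meanZ hM) ?(mean_sum hM)//; try (by move=> ?; bd); by bd.
set B := \sum_(x <- L) _.
have BW : `|B - W * kapm| <= A * s.
  rewrite /B /W mulr_suml -sumrB (le_trans (ler_norm_sum _ _ _))// /A mulr_suml.
  by apply: ler_sum => x _; rewrite -mulrBr normrM ler_wpM2l.
have : - (W * (B - W * kapm)) <= `|W| * (A * s).
  by rewrite -(normrN W) (le_trans (ler_norm _))// -mulNr normrM ler_wpM2l.
have : W ^+ 2 * (M (fun t => P t ^+ 2) - kapm) <= W ^+ 2 * s.
  by rewrite ler_wpM2l ?sqr_ge0// (le_trans (ler_norm _)).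
set m := M _; rewrite /C; lra.
Qed.

End Kernel.

(** * Lower bound for the structured part *)

Section LowerBound.
Context {R : realType} {M : (nat -> R) -> R} (hM : is_mean M).
Hypothesis M_shift : forall m a, bnd a -> M (fun n => a (n + m)%N) = M a.

(** * Convolution by the autocorrelation kernel *)

Section Conv.
Context {psi : nat -> R} (psi1 : forall n, 0 <= psi n <= 1).
Context {f : nat -> R} {K : R} (fK : forall n, `|f n| <= K).

Local Notation kap := (kap (M := M) (psi := psi)).
Local Notation kapm := (kapm (M := M) (psi := psi)).

Let bf : bnd f. Proof. by exists K. Qed.
Let bk : bnd (fun p : nat * nat => kap p.1 p.2). Proof. exact: bnd_kap. Qed.
Let bk1 x : bnd (kap x). Proof. exact: bnd_kap1. Qed.
Let bpsi : bnd psi. Proof. exact: bnd_psi. Qed.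

Definition kconv n := M (fun l => kap n l * f l).

Lemma bnd_kconv : bnd kconv.
Proof. by rewrite /kconv; bd. Qed.
Let bD := bnd_kconv.

Lemma kconv_shift n m : kconv (n + m)%N = M (fun l => kap m l * f (n + l)%N).
Proof.
rewrite /kconv -(M_shift n (a := fun l => kap (n + m) l * f l)); last bd.
by apply: eq_mean => l; rewrite [in kap _ _]addnC (kap_shift M_shift psi1) [(n + l)%N]addnC.
Qed.

Lemma kconv_norm n : `|kconv n| <= K * kapm.
Proof.
rewrite /kconv (le_trans (mean_norm hM _))//; first bd.
rewrite -(mean_kap hM M_shift psi1 n) -(meanZ hM); last bd.
apply: (le_mean hM); try bd.
move=> l; have k0 := kap_ge0 hM psi1 n l.
by rewrite normrM (ger0_norm k0) mulrC ler_wpM2r.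
Qed.

(** This is [mean_psd] for [kap - kapm] weighted by [f], positive definite by [kap_psd]; the
    constant [kapm] contributes the square of [M f]. *)
Lemma mean_kconv_ge : kapm * M f ^+ 2 <= M (fun n => f n * kconv n).
Proof.
have := @mean_psd _ _ M (fun n l => f n * f l * (kap n l - kapm)) hM.
have -> : M (fun n => M (fun l => f n * f l * (kap n l - kapm))) =
    M (fun n => f n * kconv n) - kapm * M f ^+ 2.
  rewrite (eq_mean (G := fun n => f n * kconv n - f n * (M f * kapm))); last first.
    move=> n; rewrite (eq_mean (G := fun l => f n * (kap n l * f l) - f n * (f l * kapm))).
      by rewrite (meanB hM) ?(meanZ hM) ?(meanZr hM)//; bd.
    by move=> l; ring.
  by rewrite (meanB hM) ?(meanZr hM); try bd; ring.
rewrite subr_ge0; apply; first by bd.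
  by move=> x y; rewrite (kapC (M := M)); ring.
by move=> L; exact: (kap_psd hM M_shift psi1).
Qed.

(** As [kap] lies between 0 and 1, Cauchy-Schwarz makes [c n m - kconv n * kconv m] positive
    definite, [c] being the autocorrelation of [f]. Then [mean_psd] bounds the squared mean of
    [g * kconv] by the mean of [g * A], and [energy_null] with [v = c 0] makes [A] small. *)
Lemma mean_mul_kconv g X (d : R) : bnd g -> 0 <= K -> M (fun n => g n ^+ 2) <= (2 * K) ^+ 2 ->
  (0 < size X)%N -> 0 <= d -> energy M g X <= d ^+ 2 ->
  M (fun n => g n * kconv n) ^+ 4 <= (2 * K) ^+ 2 * (K ^+ 4 * d).
Proof.
move=> bg K0 gK X0 d0 hX.
pose c x y := M (fun n => f (n + x)%N * f (n + y)%N).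
have bc : bnd (fun p : nat * nat => c p.1 p.2) by rewrite /c; bd.
have c0K y : `|c 0%N y| <= K ^+ 2.
  apply: (mean_normB hM) => n; by rewrite normrM expr2; apply: ler_pM.
have bc1 x : bnd (c x) := bnd_curry x bc.
pose A n := M (fun m => g (m + n)%N * c 0%N m).
have bA : bnd A by rewrite /A; bd.
have AK : M (fun n => A n ^+ 2) <= K ^+ 4 * d.
  apply: (energy_null hM M_shift hM M_shift (X := X)) => //.
  apply: (mean_leB hM); first by bd.
  move=> n; have -> : K ^+ 4 = (K ^+ 2) ^+ 2 by ring.
  by rewrite -[X in X <= _]real_normK ?num_real// lerXn2r ?nnegrE// exprn_ge0.
have gA : M (fun n => g n * A n) ^+ 2 <= (2 * K) ^+ 2 * (K ^+ 4 * d).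
  apply: le_trans (mean_CS hM bg bA) _; apply: ler_pM => //.
    by apply: (mean_ge0 hM) => [|n]; [bd|exact: sqr_ge0].
  by apply: (mean_ge0 hM) => [|n]; [bd|exact: sqr_ge0].
have gD : M (fun n => g n * kconv n) ^+ 2 <= M (fun n => g n * A n).
  have := @mean_psd _ _ M (fun n m => g n * g m * (c n m - kconv n * kconv m)) hM.
  have -> : M (fun n => M (fun m => g n * g m * (c n m - kconv n * kconv m))) =
      M (fun n => g n * A n) - M (fun n => g n * kconv n) ^+ 2.
    rewrite (eq_mean (G := fun n => g n * A n - (g n * kconv n) * M (fun n => g n * kconv n))).
      by rewrite (meanB hM) ?(meanZr hM) ?expr2//; bd.
    move=> n; rewrite (eq_mean (G := fun m => g n * (g m * c n m) -
        (g n * kconv n) * (g m * kconv m))); last by move=> m; ring.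
    rewrite (meanB hM) ?(meanZ hM); try bd.
    congr (_ * _ - _).
    rewrite /A -(M_shift n (a := fun m => g m * c n m)); last bd.
    apply: eq_mean => m; congr (_ * _).
    have := mean_mul_shift M_shift n 0 m bf bf; rewrite add0n; exact.
  rewrite subr_ge0; apply; first by bd.
    by move=> x y; rewrite /c (eq_mean (G := fun n => f (n + y)%N * f (n + x)%N)) => [|n]; ring.
  move=> L; pose F t := \sum_(x <- L) g x * f (t + x)%N.
  have bF : bnd F by rewrite /F; bd.
  have -> : \sum_(x <- L) \sum_(y <- L) g x * g y * (c x y - kconv x * kconv y) =
      M (fun t => F t ^+ 2) - M (fun t => F t * kap 0 t) ^+ 2.
    have -> : M (fun t => F t * kap 0 t) = \sum_(x <- L) g x * kconv x.
      rewrite (eq_mean (G := fun t => \sum_(x <- L) g x * (kap 0 t * f (x + t)%N))).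
        rewrite (mean_sum hM); last by move=> x; bd.
        apply: eq_bigr => x _; rewrite (meanZ hM); last bd.
        by rewrite -kconv_shift addn0.
      by move=> t; rewrite /F mulr_suml; apply: eq_bigr => x _; rewrite addnC; ring.
    have -> : M (fun t => F t ^+ 2) = \sum_(x <- L) \sum_(y <- L) g x * g y * c x y.
      rewrite (eq_mean (G := fun t => \sum_(x <- L) \sum_(y <- L)
        g x * g y * (f (t + x)%N * f (t + y)%N))); last first.
        move=> t; rewrite expr2 /F mulr_suml; apply: eq_bigr => x _.
        by rewrite mulr_sumr; apply: eq_bigr => y _; ring.
      rewrite (mean_sum hM); last by move=> x; bd.
      apply: eq_bigr => x _; rewrite (mean_sum hM); last by move=> y; bd.
      by apply: eq_bigr => y _; rewrite (meanZ hM)//; bd.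
    rewrite expr2 mulr_suml -sumrB; apply: eq_bigr => x _.
    by rewrite mulr_sumr -sumrB; apply: eq_bigr => y _; ring.
  rewrite subr_ge0; apply: le_trans (mean_CS hM bF (bk1 0)) _.
  rewrite -[X in _ <= X]mulr1 ler_wpM2l//.
    by apply: (mean_ge0 hM) => [|n]; [bd|exact: sqr_ge0].
  apply: (mean_leB hM); first bd.
  by move=> t; rewrite expr_le1// ?(kap_le1 hM psi1) ?(kap_ge0 hM psi1).
have -> : M (fun n => g n * kconv n) ^+ 4 = (M (fun n => g n * kconv n) ^+ 2) ^+ 2 by ring.
by apply: le_trans gA; rewrite lerXn2r ?nnegrE ?sqr_ge0// (le_trans (sqr_ge0 _) gD).
Qed.

End Conv.

(** The two means cannot be exchanged, but finitely many colours split the inner one into a finite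
    sum whose factors [V i] no longer depend on [l]. *)
Lemma color_bound (T : finType) (col : nat -> T) (V : T -> nat -> R) (th f : nat -> R) (b K : R) :
  (forall i, bnd (V i)) -> bnd th -> (forall n, `|f n| <= K) -> 0 <= b ->
  (forall l, th l != 0 -> M (fun n => V (col l) n ^+ 2) <= b ^+ 2) ->
  `|M (fun n => M (fun l => th l * V (col l) n * f (n + l)%N))| <= b * K * M (fun l => `|th l|).
Proof.
move=> bV bth fK b0 hV.
have bf : bnd f by exists K.
have K0 : 0 <= K by rewrite (le_trans _ (fK 0%N)).
pose tau i := M (fun l => `|th l| * (col l == i)%:R).
have pick (F : T -> R) l : F (col l) = \sum_i F i * (col l == i)%:R.
  rewrite (bigD1 (col l))//= eqxx mulr1 big1 ?addr0// => i /negPf.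
  by rewrite eq_sym => ->; rewrite mulr0.
have bsum (F : T -> nat -> R) : (forall i, bnd (F i)) -> bnd (fun l => F (col l) l).
  move=> bF; have : bnd (fun l => \sum_i F i l * (col l == i)%:R) by apply: bnd_sum => i; bd.
  by move=> [B hB]; exists B => l; rewrite (pick (F^~ l)).
have bVc : bnd (fun p : nat * nat => V (col p.2) p.1).
  have : bnd (fun p : nat * nat => \sum_i V i p.1 * (col p.2 == i)%:R) by apply: bnd_sum => i; bd.
  by move=> [B hB]; exists B => p; rewrite (pick (fun i => V i p.1)).
have bVn n : bnd (fun l => V (col l) n) by case: bVc => B hB; exists B => l; exact: (hB (n, l)).
apply: le_trans (mean_norm hM _) _; first by bd.
apply: (@le_trans _ _ (M (fun n => \sum_i `|V i n| * (K * tau i)))).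
  apply: (le_mean hM); try by bd.
  move=> n; apply: le_trans (mean_norm hM _) _; first by bd.
  apply: (@le_trans _ _ (M (fun l => \sum_i `|V i n| * (K * (`|th l| * (col l == i)%:R))))).
    apply: (le_mean hM); try by bd.
    move=> l; have -> : \sum_i `|V i n| * (K * (`|th l| * (col l == i)%:R)) =
        `|V (col l) n| * (K * `|th l|).
      rewrite (pick (fun i => `|V i n| * (K * `|th l|))).
      by apply: eq_bigr => i _; rewrite !mulrA.
    by rewrite !normrM [X in X * _]mulrC -mulrA [K * _]mulrC !ler_wpM2l.
  rewrite (mean_sum hM); last by move=> i; bd.
  by apply: ler_sum => i _; rewrite !(meanZ hM)//; bd.
rewrite (mean_sum hM); last by move=> i; bd.
have -> : M (fun l => `|th l|) = \sum_i tau i.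
  rewrite -(mean_sum hM); last by move=> i; bd.
  by apply: eq_mean => l; exact: (pick (fun=> `|th l|)).
rewrite mulr_sumr; apply: ler_sum => i _.
rewrite (meanZr hM); last by bd.
rewrite mulrA.
have t0 : 0 <= tau i by apply: (mean_ge0 hM) => [|l]; [bd|rewrite mulr_ge0].
(* The bound on [V i] is known only if colour [i] occurs where [th] is nonzero, which is automatic
   when [tau i] is nonzero. *)
have [->|tn0] := eqVneq (tau i) 0; first by rewrite !mulr0.
rewrite ler_wpM2r// ler_wpM2r//.
have [l /andP[/eqP <- thl]] : exists l, (col l == i) && (th l != 0).
  apply: contrapT => nl; move/eqP: tn0; apply.
  rewrite -(mean_cst hM 0); apply: eq_mean => l.
  case: eqP => [cl|_]; last by rewrite mulr0.
  case: (eqVneq (th l) 0) => [->|thl]; first by rewrite normr0 mul0r.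
  by exfalso; apply: nl; exists l; rewrite cl eqxx.
rewrite -ler_sqr ?nnegrE//; last by apply: (mean_ge0 hM) => //; bd.
apply: le_trans (hV l thl).
have := mean_sqr_le hM (bnd_norm (bV (col l))).
rewrite [X in _ <= X -> _](eq_mean (G := fun n => V (col l) n ^+ 2))// => n.
by rewrite real_normK ?num_real.
Qed.

(* [r l] is a representative of the colour class of [l] for [cpt e u], so that
   [T^(r l) u] is close to [T^l u], but takes only finitely many values. *)
Lemma structured_lower_bound f u (K e : R) (T : finType) (col : nat -> T) (r : nat -> nat) :
  1 <= K -> (forall n, `|f n| <= K) -> bnd u -> 0 < e -> M (fun n => u n ^+ 2) <= (3 * K) ^+ 2 ->
  (forall h h', col h = col h' -> M (fun n => (u (n + h)%N - u (n + h')%N) ^+ 2) <= e ^+ 2) ->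
  (forall l, col (r l) = col l) -> (forall l l', col l = col l' -> r l = r l') ->
  (forall d, 0 < d -> exists u' X, [/\ bnd u', M (fun n => (u n - u' n) ^+ 2) <= e ^+ 2,
      M (fun n => (f n - u' n) ^+ 2) <= (2 * K) ^+ 2,
      (0 < size X)%N & energy M (fun n => f n - u' n) X <= d]) ->
  M f ^+ 2 - 7 * K ^+ 2 * e <= M (fun n => M (fun l => u (n + r l)%N * f (n + l)%N)).
Proof.
move=> K1 fK bu e0 uK hcol rcol reps happ.
have K0 : 0 < K by lra.
have bf : bnd f by exists K.
(* Reindexes [r] by colours, for [color_bound]; 0 is a dummy for colours never taken. *)
pose rep (i : T) := if pselect (exists l, col l = i) is left h then r (projT1 (cid h)) else 0%N.
have repE l : rep (col l) = r l.
  rewrite /rep; case: pselect => [h|nh]; last by exfalso; apply: nh; exists l.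
  by apply: reps; case: cid.
pose chi i (l : nat) : R := (col l == i)%:R.
have chi1 i n : 0 <= chi i n <= 1 by rewrite /chi; case: eqP => _; rewrite lexx ler01.
have [i chi_pos] : exists i, 0 < M (chi i).
  apply: contrapT => ni.
  have : M (fun l => \sum_i chi i l) = 1.
    rewrite -(mean1 hM); apply: eq_mean => l; rewrite (bigD1 (col l))//= big1 ?addr0.
      by rewrite /chi eqxx.
    by move=> i /negPf; rewrite /chi eq_sym => ->.
  rewrite (mean_sum hM); last by move=> i; exact: bnd_psi.
  have : \sum_i M (chi i) <= 0.
    apply: sumr_le0 => i _; rewrite leNgt; apply/negP => h; apply: ni; by exists i.
  by move=> h1 h2; move: h1; rewrite h2 ler10.
pose psi := chi i; have psi1 := chi1 i; rewrite -/psi in psi1.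
pose kp := kap (M := M) (psi := psi); pose kb := kapm (M := M) (psi := psi).
have kb0 : 0 < kb by apply: lt_le_trans (kapm_ge hM M_shift psi1); rewrite exprn_gt0.
have bk : bnd (fun p : nat * nat => kp p.1 p.2) by exact: bnd_kap.
have bk1 x : bnd (kp x) by exact: bnd_kap1.
pose D := @kconv psi f.
have bD : bnd D by exact: (bnd_kconv psi1 fK).
have shift_diff h x y : M (fun n => (u (n + (x + h))%N - u (n + (y + h))%N) ^+ 2) =
    M (fun n => (u (n + x)%N - u (n + y)%N) ^+ 2).
  rewrite -(M_shift h (a := fun n => (u (n + x)%N - u (n + y)%N) ^+ 2)); last bd.
  by apply: eq_mean => n; rewrite !addnA !(addnAC _ h).
(* A nonzero value yields [t] with [t + x] and [t + y] both of colour [i]; by invariance the common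
   shift [t] can be removed. *)
have kp_near x y : kp x y != 0 -> M (fun n => (u (n + x)%N - u (n + y)%N) ^+ 2) <= e ^+ 2.
  move=> kn0; have [t /andP[/eqP h1 /eqP h2]] : exists t, (col (t + x)%N == i) && (col (t + y)%N == i).
    apply: contrapT => nt; move/eqP: kn0; apply.
    rewrite /kp /kap -(mean_cst hM 0); apply: eq_mean => t; rewrite /psi /chi.
    case: eqP => [h1|_]; last by rewrite mul0r.
    case: eqP => [h2|_]; last by rewrite mulr0.
    by exfalso; apply: nt; exists t; rewrite h1 h2 eqxx.
  by rewrite -(shift_diff t) ![(_ + t)%N]addnC; apply: hcol; rewrite h1.
set be := M (fun n => M _).
have [Y [Y0 hY _]] := kap_avg hM M_shift psi1 (mulr_gt0 e0 kb0).
pose phi l := avgz Y (fun y _ => kp l y) tt.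
have bphi : bnd phi.
  have bk2 y : bnd (fun l => kp l y) by apply: bnd_comp2.
  by rewrite /phi /avgz; bd.
have bur : bnd (fun p : nat * nat => u (p.1 + r p.2)%N) by bd.
have u3 : 0 <= 3 * K by rewrite mulr_ge0// ltW.
(* Replaces the constant [kb] by [phi], the average of [kp m l] over [m] in [Y]. *)
have step1 : `|kb * be - M (fun n => M (fun l => phi l * u (n + r l)%N * f (n + l)%N))| <=
    3 * K * K * (e * kb).
  have -> : kb * be - M (fun n => M (fun l => phi l * u (n + r l)%N * f (n + l)%N)) =
      M (fun n => M (fun l => (kb - phi l) * u (n + rep (col l))%N * f (n + l)%N)).
    rewrite /be -(meanZ hM) -?(meanB hM); try by bd.
    apply: eq_mean => n; rewrite -(meanZ hM) -?(meanB hM); try by bd.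
    by apply: eq_mean => l; rewrite repE; ring.
  apply: le_trans (color_bound (V := fun i n => u (n + rep i)%N) _ _ fK u3 _) _.
  - by move=> j; bd.
  - by bd.
  - by move=> l _; rewrite (M_shift (rep (col l)) (a := fun n => u n ^+ 2))//; bd.
  - rewrite ler_wpM2l ?mulr_ge0 ?(ltW K0)//; apply: (mean_leB hM); first bd.
    by move=> l; rewrite distrC; exact: hY.
(* On the support of [kp m], both [T^(r l) u] and [T^m u] are within [e] of [T^l u]. *)
have step2 m : `|M (fun n => M (fun l => kp m l * u (n + r l)%N * f (n + l)%N)) -
    M (fun n => u n * D n)| <= (e + e) * K * kb.
  have -> : M (fun n => u n * D n) = M (fun n => M (fun l => kp m l * u (n + m)%N * f (n + l)%N)).
    rewrite -(M_shift m (a := fun n => u n * D n)); last bd.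
    apply: eq_mean => n; rewrite /D (kconv_shift psi1 fK).
    rewrite -(meanZ hM); last by bd.
    by apply: eq_mean => l; rewrite -/kp; ring.
  have -> : M (fun n => M (fun l => kp m l * u (n + r l)%N * f (n + l)%N)) -
      M (fun n => M (fun l => kp m l * u (n + m)%N * f (n + l)%N)) =
      M (fun n => M (fun l => kp m l * (u (n + rep (col l))%N - u (n + m)%N) * f (n + l)%N)).
    rewrite -(meanB hM); try by bd.
    apply: eq_mean => n; rewrite -(meanB hM); try by bd.
    by apply: eq_mean => l; rewrite repE; ring.
  have e2 : 0 <= e + e by rewrite addr_ge0// ltW.
  apply: le_trans (color_bound (V := fun i n => u (n + rep i)%N - u (n + m)%N) _ _ fK e2 _) _.
  - by move=> j; bd.
  - by bd.
  - move=> l kn0; rewrite (eq_mean (G := fun n =>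
        ((u (n + r l)%N - u (n + l)%N) + (u (n + l)%N - u (n + m)%N)) ^+ 2)); last first.
      by move=> n; rewrite repE; ring.
    apply: (mean_sqD hM); try bd; try exact: ltW; first by apply: hcol.
    by apply: kp_near; rewrite /kp (kapC (M := M)).
  - rewrite ler_wpM2l ?mulr_ge0 ?(ltW K0)//.
    rewrite (eq_mean (G := kp m)) ?(mean_kap hM M_shift psi1)// => l.
    by rewrite ger0_norm// (kap_ge0 hM psi1).
have step3 : `|M (fun n => M (fun l => phi l * u (n + r l)%N * f (n + l)%N)) -
    M (fun n => u n * D n)| <= (e + e) * K * kb.
  have -> : M (fun n => M (fun l => phi l * u (n + r l)%N * f (n + l)%N)) =
      avgz Y (fun m _ => M (fun n => M (fun l => kp m l * u (n + r l)%N * f (n + l)%N))) tt.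
    rewrite /avgz -(mean_sum hM) -?(meanZ hM); try (by move=> ?; bd); try by bd.
    apply: eq_mean => n; rewrite -(mean_sum hM) -?(meanZ hM); try (by move=> ?; bd); try by bd.
    apply: eq_mean => l; rewrite /phi /avgz -!mulrA mulr_suml; congr (_ * _).
    by apply: eq_bigr => y _; rewrite mulrA /kp (kapC (M := M)).
  exact: avgz_dist.
have step4 : M (fun n => f n * D n) - 2 * (K * e * kb) <= M (fun n => u n * D n).
  (* Chosen so that [mean_mul_kconv] bounds the mean of [(f - u') * D] by [e * kb]. *)
  pose d := (e * kb) ^+ 4 / ((2 * K) ^+ 2 * K ^+ 4).
  have KK : 0 < (2 * K) ^+ 2 * K ^+ 4 by rewrite mulr_gt0 ?exprn_gt0// mulr_gt0.
  have d0 : 0 < d by rewrite divr_gt0// exprn_gt0// mulr_gt0.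
  have [u' [X [bu' uu' fu' X0 hX]]] := happ _ (exprn_gt0 2 d0).
  have bg : bnd (fun n => f n - u' n) by bd.
  have := mean_mul_kconv psi1 fK bg (ltW K0) fu' X0 (ltW d0) hX.
  rewrite -/D mulrA [X in _ <= X]mulrC /d divfK ?gt_eqF// => h4.
  have ekb : 0 <= e * kb by rewrite mulr_ge0// ltW.
  have h5 : `|M (fun n => (f n - u' n) * D n)| <= e * kb.
    rewrite leNgt; apply/negP => lt.
    have : (e * kb) ^+ 4 < `|M (fun n => (f n - u' n) * D n)| ^+ 4 by rewrite ltrXn2r.
    by rewrite -normrX ltNge (ger0_norm (exprn_even_ge0 _ _))// h4.
  have h6 : `|M (fun n => (u n - u' n) * D n)| <= e * (K * kb).
    apply: (mean_sqM_le hM) => //; try bd; [exact: ltW|by rewrite mulr_ge0// ltW|].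
    apply: (mean_leB hM); first bd.
    move=> n; rewrite -[X in X <= _]real_normK ?num_real//.
    have := kconv_norm psi1 fK n; rewrite -/kb -/D => h.
    by rewrite lerXn2r ?nnegrE// mulr_ge0// ltW.
  have -> : M (fun n => u n * D n) = M (fun n => f n * D n) -
      M (fun n => (f n - u' n) * D n) + M (fun n => (u n - u' n) * D n).
    rewrite -(meanB hM) -?(meanD hM); try by bd.
    by apply: eq_mean => n; ring.
  have : e * kb <= K * e * kb by rewrite -mulrA ler_peMl.
  move: h5 h6; rewrite !ler_norml => /andP[_ h5] /andP[h6 _]; lra.
have step5 := mean_kconv_ge psi1 fK; rewrite -/D -/kb in step5.
(* In units of [e * kb], the losses are [3 * K ^ 2] from [step1] and [2 * K] from each of [step3]
   and [step4]. *)
rewrite -(ler_pM2l kb0).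
have KK : K * (e * kb) <= K ^+ 2 * (e * kb).
  by rewrite expr2 -mulrA ler_peMl// !mulr_ge0// ltW.
move: step1 step3; rewrite !ler_norml => /andP[s1 _] /andP[s3 _].
lra.
Qed.

End LowerBound.

(** * Intersectivity *)

Section Intersectivity.
Context {R : realType} {M : (nat -> R) -> R} (hM : is_mean M).

Definition ind (B : set nat) (l : nat) : R := (`[< B l >])%:R.

Lemma bnd_ind B : bnd (ind B). Proof. exact: bnd_nat. Qed.
Let bi := bnd_ind.

Lemma ind_ge0 B l : 0 <= ind B l. Proof. by rewrite /ind. Qed.

Lemma ind_sub B C l : (B l -> C l) -> ind B l <= ind C l.
Proof.
rewrite /ind => BC; case: asboolP => [Bl|_]; last by rewrite ler0n.
by rewrite asboolT//; exact: BC.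
Qed.

Lemma indI B C l : ind (B `&` C) l = ind B l * ind C l.
Proof. by rewrite /ind asbool_and -natrM mulnb. Qed.

Lemma mean_ind_ge0 B : 0 <= M (ind B).
Proof. by apply: (mean_ge0 hM) => // l; exact: ind_ge0. Qed.

Lemma mean_ind_sub B C : B `<=` C -> M (ind B) <= M (ind C).
Proof. by move=> BC; apply: (le_mean hM) => // l; apply: ind_sub; exact: BC. Qed.

Lemma mean_ind_le1 B : M (ind B) <= 1.
Proof. by apply: (mean_leB hM) => // l; rewrite /ind; case: `[< _ >]; rewrite ?ler01. Qed.

Lemma mean_ind0 : M (ind set0) = 0.
Proof. by rewrite -(mean_cst hM 0); apply: eq_mean => l; rewrite /ind asboolF. Qed.

Lemma mean_indU B C : M (ind (B `|` C)) <= M (ind B) + M (ind C).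
Proof.
rewrite -(meanD hM)//; apply: (le_mean hM) => //; first bd.
move=> l; rewrite /ind asbool_or.
by case: `[< B l >]; case: `[< C l >]; rewrite /= ?addr0 ?add0r// lerDl ler01.
Qed.

Context {p : set_system nat} (pU : UltraFilter p) (pinf : \oo `<=` p).
Context (A : nat -> set nat).

(** The property carried along the selection: it forces [E] to have positive mean and still lets a
    further [A N] be intersected. *)
Let big (E : set nat) := 0 < ulim p (fun N => M (ind (E `&` A N))).

Let bE (E : set nat) (B : nat -> set nat) : bnd (fun N => M (ind (E `&` B N))).
Proof. by exists 1 => N; rewrite ger0_norm ?mean_ind_ge0// mean_ind_le1. Qed.

(* Positivity of the iterated limit of the kernel [M (1_(E & A N) 1_(E & A N'))] minus
   its rank one part replaces Fatou's lemma in Bergelson's intersectivity argument. *)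
Let big_step E n : big E -> exists2 N, (n < N)%N & big (E `&` A N).
Proof.
have hp := is_mean_ulim (R := R) pU.
rewrite /big => bigE.
pose a N := M (ind (E `&` A N)).
pose b N := ulim p (fun N' => M (ind ((E `&` A N) `&` A N'))).
have ba : bnd a by exact: bE.
have bb2 : bnd (fun q : nat * nat => M (ind ((E `&` A q.1) `&` A q.2))).
  by exists 1 => q; rewrite ger0_norm ?mean_ind_ge0// mean_ind_le1.
have bb : bnd b by exact: (bnd_mean hp (K := fun N N' => M (ind ((E `&` A N) `&` A N')))).
have kE N N' : M (ind ((E `&` A N) `&` A N')) = M (fun l => ind (E `&` A N) l * ind (E `&` A N') l).
  apply: eq_mean => l; rewrite !indI /ind.
  by case: `[< E l >]; rewrite ?mul1r ?mul0r.
have := @mean_psd _ _ (ulim p) (fun N N' => M (ind ((E `&` A N) `&` A N')) - a N * a N') hp.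
have -> : ulim p (fun N => ulim p (fun N' => M (ind ((E `&` A N) `&` A N')) - a N * a N')) =
    ulim p b - ulim p a ^+ 2.
  rewrite (eq_mean (G := fun N => b N - a N * ulim p a)).
    by rewrite (meanB hp) ?(meanZr hp) ?expr2//; bd.
  by move=> N; rewrite (meanB hp) ?(meanZ hp)//; bd.
move=> H; have b0 : 0 < ulim p b.
  apply: lt_le_trans (_ : ulim p a ^+ 2 <= _); first by rewrite exprn_gt0.
  rewrite -subr_ge0; apply: H.
  - by apply: (bndD (F := fun q : nat * nat => M (ind ((E `&` A q.1) `&` A q.2)))) => //; bd.
  - by move=> N N'; rewrite mulrC !kE; congr (_ - _); apply: eq_mean => l; rewrite mulrC.
  - move=> L; pose F l := \sum_(N <- L) ind (E `&` A N) l.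
    have -> : \sum_(N <- L) \sum_(N' <- L) (M (ind ((E `&` A N) `&` A N')) - a N * a N') =
        M (fun l => F l ^+ 2) - M F ^+ 2.
      have -> : M F = \sum_(N <- L) a N by rewrite (mean_sum hM).
      rewrite (eq_mean (G := fun l => \sum_(N <- L) \sum_(N' <- L)
          ind (E `&` A N) l * ind (E `&` A N') l)); last first.
        by move=> l; rewrite expr2 mulr_suml; apply: eq_bigr => N _; rewrite mulr_sumr.
      rewrite (mean_sum hM); last by move=> N; bd.
      rewrite expr2 mulr_suml -sumrB; apply: eq_bigr => N _.
      rewrite (mean_sum hM); last by move=> N'; bd.
      by rewrite mulr_sumr -sumrB; apply: eq_bigr => N' _; rewrite kE.
    by rewrite subr_ge0; apply: (mean_sqr_le hM); rewrite /F; bd.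
have [N nN hN] := free_ultra_ex n pU pinf (ulim_near pU bb b0).
exists N => //; move: hN => /=; rewrite ltr_norml => /andP[h _].
by rewrite -/(b N); lra.
Qed.

(** Repeated use of [big_step] gives decreasing intersections [E j] of positive mean. Together with
    the complements of null sets they still generate a proper filter, and an ultrafilter above it
    contains no null set. *)
Lemma intersectivity (d : R) : 0 < d -> p [set N | d <= M (ind (A N))] ->
  exists (q : set_system nat) (s : nat -> nat),
  [/\ UltraFilter q, forall B, q B -> 0 < M (ind B),
    forall k, (s k < s k.+1)%N & forall k, q (A (s k))].
Proof.
move=> d0 hA.
have bigT : big setT.
  apply: lt_le_trans d0 _; apply: (ulim_ge pU (bE _ _)).
  by apply: filterS hA => N; rewrite /= setTI.
have /choice[g hg] : forall En : set nat * nat, exists N, big En.1 -> (En.2 < N)%N /\ big (En.1 `&` A N).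
  move=> [E n] /=; have [bE1|nb] := pselect (big E); last by exists 0%N.
  by have [N nN bN] := big_step n bE1; exists N.
pose st := fix st j := if j is j'.+1 then let x := st j' in (x.1 `&` A (g x), g x) else (setT, 0%N).
have bst j : big (st j).1 by elim: j => //= j ih; case: (hg (st j) ih).
pose E j := (st j).1.
have Emono i j : (i <= j)%N -> E j `<=` E i.
  move=> /subnK <-; elim: (j - i)%N => //= k ih l [El _]; exact: ih.
have Epos j : 0 < M (ind (E j)).
  apply: lt_le_trans (bst j) _.
  have := mean_leB (is_mean_ulim pU) (bE (E j) A) (B := M (ind (E j))); apply => N.
  by apply: mean_ind_sub => l [].
pose F := [set B : set nat | exists k, M (ind (E k `\` B)) = 0].
have M0 B C : B `<=` C -> M (ind C) = 0 -> M (ind B) = 0.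
  by move=> BC C0; apply/le_anti; rewrite mean_ind_ge0 -C0 mean_ind_sub.
have FF : ProperFilter F.
  split.
    by move=> [k]; rewrite setD0 => h; have := Epos k; rewrite h ltxx.
  split.
  - by exists 0%N; rewrite setDT mean_ind0.
  - move=> B C [k hk] [k' hk']; exists (maxn k k').
    apply: (@M0 _ ((E k `\` B) `|` (E k' `\` C))).
      move=> l [El nBC]; have [Bl|nB] := pselect (B l).
        right; split; first exact: Emono (leq_maxr k k') _ El.
        by move=> Cl; apply: nBC.
      by left; split => //; exact: Emono (leq_maxl k k') _ El.
    apply/le_anti; rewrite mean_ind_ge0 andbT.
    by rewrite (le_trans (mean_indU _ _))// hk hk' addr0.
  - move=> B C BC [k hk]; exists k; apply: M0 hk => l [El nC]; split => // Bl; exact/nC/BC.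
have [q [qU Fq]] := ultraFilterLemma FF.
(* The initial index 0 is not a choice; the index in [st k.+1] is the one whose set was intersected
   to form [E k.+1]. *)
exists q, (fun k => (st k.+1).2); split => //.
- move=> B qB; rewrite lt_neqAle mean_ind_ge0 andbT eq_sym; apply/eqP => B0.
  have qnB : q (~` B).
    apply: Fq; exists 0%N; apply: M0 B0 => l [_]; exact: contrapT.
  have [q0 [_ qI _]] := @ultra_proper _ _ qU.
  by apply: q0; rewrite -(setICr B); exact: qI.
- by move=> k; case: (hg (st k.+1) (bst k.+1)).
- move=> k; apply: Fq; exists k.+1.
  by rewrite -mean_ind0; congr (M (ind _)); apply/seteqP; split => // l [[_ Al] /(_ Al)].
Qed.

End Intersectivity.

(** * Passage to subsequences and the final assembly *)

Section Assembly.
Context {R : realType}.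

Lemma avg_mul (Phi : nat -> {fset nat}) (a b : nat -> R) :
  avg Phi a b = avg Phi (fun=> 1) (fun n => a n * b n).
Proof. by apply/funext => N; rewrite /avg; congr (_ * _); apply: eq_bigr => n _; rewrite mul1r. Qed.

Lemma mean_avg {T : Type} {M : (T -> R) -> R} (hM : is_mean M) (Phi : nat -> {fset nat})
    (h : nat -> T -> R) N : (forall n, bnd (h n)) ->
  M (fun l => avg Phi (fun=> 1) (h^~ l) N) = avg Phi (fun=> 1) (fun n => M (h n)) N.
Proof.
move=> bh; rewrite /avg (meanZ hM); last bd.
congr (_ * _); rewrite (mean_sum hM); last by move=> n; bd.
by apply: eq_bigr => n _; rewrite (meanZ hM).
Qed.

Lemma ultra_color (q : set_system nat) (T : finType) (col : nat -> T) :
  UltraFilter q -> exists i, q [set l | col l = i].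
Proof.
move=> qU; have [q0 [qT qI qS]] := @ultra_proper _ _ qU.
have key (s : seq T) : q [set l | col l \in s] -> exists i, q [set l | col l = i].
  elim: s => [|i s ih] qs; first by exfalso; apply: q0; apply: qS qs.
  have [qi|qni] := in_ultra_setVsetC [set l | col l = i] qU; first by exists i.
  apply: ih; apply: qS (qI _ _ qs qni) => l [/=].
  by rewrite in_cons => /predU1P[->|].
by apply: (key (enum T)); apply: qS qT => l _ /=; rewrite mem_enum.
Qed.

Lemma bounded_fun_bnd (f : nat -> R) : bounded_fun f -> exists2 K, 1 <= K & forall n, `|f n| <= K.
Proof.
move=> [B [_ hB]]; exists (`|B| + 1); first by rewrite lerDr.
by move=> n; apply: (hB (`|B| + 1)) => //; rewrite (le_lt_trans (ler_norm _))// ltrDl.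
Qed.

(** Bilinearity carries convergence from pairs of shifts of [f] to pairs from the span. *)
Lemma span_cvgn (Phi : nat -> {fset nat}) (M : (nat -> R) -> R) f u v : is_mean M -> bnd f ->
  (forall i j, avg Phi (fun=> 1) (fun n => f (n + i)%N * f (n + j)%N) @ \oo -->
     M (fun n => f (n + i)%N * f (n + j)%N)) ->
  shift_span f u -> shift_span f v ->
  avg Phi (fun=> 1) (fun n => u n * v n) @ \oo --> M (fun n => u n * v n).
Proof.
move=> hM bf hc su sv.
have lin (a b : R) (x y z : nat -> R) : bnd x -> bnd y -> bnd z ->
    avg Phi (fun=> 1) (fun n => x n * z n) @ \oo --> M (fun n => x n * z n) ->
    avg Phi (fun=> 1) (fun n => y n * z n) @ \oo --> M (fun n => y n * z n) ->
    avg Phi (fun=> 1) (fun n => (a * x n + b * y n) * z n) @ \oo -->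
      M (fun n => (a * x n + b * y n) * z n).
  move=> bx by_ bz hx hy.
  have E n : (a * x n + b * y n) * z n = a * (x n * z n) + b * (y n * z n) by ring.
  rewrite (funext E) (meanD hM) ?(meanZ hM); try bd.
  have -> : avg Phi (fun=> 1) (fun n => a * (x n * z n) + b * (y n * z n)) =
      (fun N => a * avg Phi (fun=> 1) (fun n => x n * z n) N +
                b * avg Phi (fun=> 1) (fun n => y n * z n) N).
    by apply/funext => N; rewrite avgD !avgZ.
  by apply: cvgD; apply: cvgMl_tmp.
elim: su => [i|a b x y sx hx sy hy]; last first.
  by apply: lin => //; exact: span_bnd sv || exact: span_bnd sx || exact: span_bnd sy.
elim: sv => [j|a b x y sx hx sy hy]; first exact: hc.
have C w z : (fun n : nat => w n * z n : R) = (fun n => z n * w n).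
  by apply/funext => n; rewrite mulrC.
rewrite C; apply: lin; try by rewrite C.
- exact: span_bnd sx.
- exact: span_bnd sy.
- bd.
Qed.

(* [M] averages along [Phi1] over the shift [m], [N] along a further subsequence over [n];
   the two agree on products of elements of the span of the shifts of [f]. *)
Lemma mean_bad_set (M N : (nat -> R) -> R) (f u v : nat -> R) (K e : R) :
  is_mean M -> (forall m a, bnd a -> M (fun n => a (n + m)%N) = M a) ->
  is_mean N -> (forall m a, bnd a -> N (fun n => a (n + m)%N) = N a) ->
  (forall x y, shift_span f x -> shift_span f y ->
     N (fun n => x n * y n) = M (fun n => x n * y n)) ->
  bnd f -> shift_span f u -> 0 < K -> (forall n, `|v n| <= K) -> 0 < e ->
  (forall d, 0 < d -> exists u' X, [/\ shift_span f u', M (fun n => (u n - u' n) ^+ 2) <= e ^+ 2,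
      (0 < size X)%N & energy M (fun n => f n - u' n) X <= d]) ->
  M (ind [set m | 2 * (e * K) < `|N (fun n => (f (n + m)%N - u (n + m)%N) * v n)|]) = 0.
Proof.
move=> hM M_shift hN N_shift MN bf su K0 vK e0 happ.
have bv : bnd v by exists K.
have bu := span_bnd bf su.
have sf := span_self f.
set Bad := [set m | _].
have eK0 : 0 < e * K by rewrite mulr_gt0.
have v2 : N (fun n => v n ^+ 2) <= K ^+ 2.
  apply: (mean_leB hN) => [|n]; first bd.
  by rewrite -[X in X <= _]real_normK ?num_real// lerXn2r ?nnegrE// ltW.
apply/le_anti; rewrite mean_ind_ge0// andbT leNgt; apply/negP => Bpos.
(* Chebyshev: on [Bad] the correlation [b] with [f - u'] is at least [e * K] in absolute value,
   while this [d] makes its mean square at most half of [(e * K) ^ 2 * M (ind Bad)]. *)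
pose d := M (ind Bad) * e ^+ 2 / 2.
have d0 : 0 < d by rewrite divr_gt0// mulr_gt0// exprn_gt0.
have [u' [X [su' uu' X0 hX]]] := happ _ (exprn_gt0 2 d0).
have bu' := span_bnd bf su'.
have sg := spanB sf su'.
have bg : bnd (fun n => f n - u' n) by bd.
have hXN : energy N (fun n => f n - u' n) X <= d ^+ 2.
  apply: le_trans hX; rewrite le_eqVlt; apply/orP; left; apply/eqP.
  rewrite /energy /avgz; congr (_ * _); apply: eq_bigr => y _; congr (_ * _).
  apply: eq_bigr => x _; congr (_ ^+ 2).
  exact: (MN _ _ (span_shifted x sg) (span_shifted y sg)).
have := energy_null hM M_shift hN N_shift bg bv (ltW d0) v2 X0 hXN.
pose b m := N (fun n => (f (n + m)%N - u' (n + m)%N) * v n).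
have bb : bnd b by rewrite /b; bd.
rewrite -/(b _) => hb.
have : (e * K) ^+ 2 * M (ind Bad) <= M (fun m => b m ^+ 2).
  have bi := bnd_ind (R := R) Bad.
  rewrite -(meanZ hM)//; apply: (le_mean hM); try bd.
  move=> m; rewrite /ind; case: asboolP => [/= hm|_]; last by rewrite mulr0 sqr_ge0.
  rewrite mulr1 -[X in _ <= X]real_normK ?num_real// lerXn2r ?nnegrE// ?(ltW eK0)//.
  have h1 : `|N (fun n => (u (n + m)%N - u' (n + m)%N) * v n)| <= e * K.
    apply: (mean_sqM_le hN) => //; try bd; try exact: ltW.
    rewrite (N_shift m (fun n => (u n - u' n) ^+ 2)); last bd.
    have suu := spanB su su'.
    rewrite (eq_mean (G := fun n => (u n - u' n) * (u n - u' n))); last by move=> n; rewrite expr2.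
    by rewrite (MN _ _ suu suu) (eq_mean (G := fun n => (u n - u' n) ^+ 2))// => n; rewrite expr2.
  have -> : b m = N (fun n => (f (n + m)%N - u (n + m)%N) * v n) +
      N (fun n => (u (n + m)%N - u' (n + m)%N) * v n).
    by rewrite -(meanD hN); try bd; apply: eq_mean => n; ring.
  have tri (x y : R) : 2 * (e * K) < `|x| -> `|y| <= e * K -> e * K <= `|x + y|.
    by move=> hx hy; have := ler_normB (x + y) y; rewrite addrK; lra.
  exact: tri.
move=> h; have := le_trans h hb; rewrite /d.
have -> : K ^+ 2 * (M (ind Bad) * e ^+ 2 / 2) = (e * K) ^+ 2 * M (ind Bad) / 2 by ring.
have : 0 < (e * K) ^+ 2 * M (ind Bad) by rewrite mulr_gt0// exprn_gt0.
lra.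
Qed.

End Assembly.

Theorem theorem2p7 (R : realType) (f : nat -> R) (Phi : nat -> {fset nat}) :
  (forall n, 0 <= f n) -> bounded_fun f -> Folner (R := R) Phi ->
  inner_exists Phi (fun _ => 1) f ->
  forall eps : R, 0 < eps ->
  exists (Psi : nat -> {fset nat}) (p : set_system nat),
    subsequence_of Psi Phi /\ UltraFilter p /\ nonprincipal p /\
    (forall m : nat, (0 < m)%N -> inner_exists Psi (shiftR m f) (shiftRp p f)) /\
    ulim p (fun m => inner Psi (shiftR m f) (shiftRp p f))
      >= (inner Psi (fun _ => 1) f) ^+ 2 - eps.
Proof.
move=> _ /bounded_fun_bnd[K K1 fK] FPhi fcvg eps eps0.
have K0 : 0 < K by lra.
have bf : bnd f by exists K.
have [p pU pinf] := ex_free_ultra.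
(* First extraction: the correlations of any two shifts of [f] converge, so means along later
   subsequences agree with [M] on products from the span. *)
have [s1 hs1 cs1] := @diagonal_extraction R (nat * nat)%type p
  (fun ij => avg Phi (fun=> 1) (fun n => f (n + ij.1)%N * f (n + ij.2)%N)) pU pinf
  (fun ij => bnd_avg Phi (bndM (bnd_comp (fun n => (n + ij.1)%N) bf) (bnd_comp (fun n => (n + ij.2)%N) bf))).
pose Phi1 := Phi \o s1.
have FPhi1 : Folner (R := R) Phi1 by exact: Folner_subseq.
pose M := fmean (R := R) p Phi1.
have hM : is_mean M := is_mean_fmean pU FPhi1.
have M_shift : forall m a, bnd a -> M (fun n => a (n + m)%N) = M a.
  by move=> m a; exact: (fmean_shift pU pinf FPhi1).
pose al := limn (avg Phi (fun=> 1) f).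
have Mf : M f = al by apply: (fmean_cvgn pU pinf); exact: (cvg_subseq hs1 fcvg).
have ffM i j : avg Phi1 (fun=> 1) (fun n => f (n + i)%N * f (n + j)%N) @ \oo -->
    M (fun n => f (n + i)%N * f (n + j)%N).
  by have h := cs1 (i, j); rewrite /M (fmean_cvgn pU pinf h).
(* Losses in units of [e]: [7 * K ^ 2] in [low], 2 in [low2], [2 * K] off the bad set and [K] in
   [h1], together at most [12 * K ^ 2]. *)
pose e := eps / (12 * K ^+ 2).
have KK0 : 0 < 12 * K ^+ 2 by rewrite mulr_gt0// exprn_gt0.
have e0 : 0 < e by rewrite divr_gt0.
have f2 : M (fun n => f n ^+ 2) <= K ^+ 2.
  apply: (mean_leB hM) => [|n]; first bd.
  by rewrite -[X in X <= _]real_normK ?num_real// lerXn2r ?nnegrE// ltW.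
have [u [su [T [col hcol]] u2 happ]] := cpt_decomposition hM M_shift bf K1 f2 e0.
have bu := span_bnd bf su.
pose rep (i : T) := if pselect (exists l, col l = i) is left h then projT1 (cid h) else 0%N.
have repK l : col (rep (col l)) = col l.
  by rewrite /rep; case: pselect => [h|[]]; [case: cid|exists l].
pose h n l := u (n + rep (col l))%N * f (n + l)%N.
pose be := M (fun n => M (h n)).
have low : al ^+ 2 - 7 * K ^+ 2 * e <= be.
  rewrite -Mf; apply: (structured_lower_bound hM M_shift (col := col)) => //.
    by move=> l l' ->.
  move=> d d0; have [u' [X [su' ? ? ? ?]]] := happ d d0.
  by exists u', X; split => //; exact: span_bnd su'.
have [Bu Bu0 uB] := bnd_pos bu.
pose g N l := avg Phi1 (fun=> 1) (h^~ l) N.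
pose B := Bu * K.
have hB n l : `|h n l| <= B by rewrite normrM ler_pM.
have bh : bnd (fun q : nat * nat => h q.1 q.2) by exists B.
have bh1 n : bnd (h n) by exists B.
have gB N l : `|g N l| <= B by apply: avg_normB => n; exact: hB.
have bg N : bnd (g N) by exists B.
have beB : `|be| <= B by apply: (mean_normB hM) => n; exact: (mean_normB hM).
pose A N := [set l | be - 2 * e <= g N l].
have B0 : 0 < B by rewrite mulr_gt0.
have C0 : 0 < 2 * B + 2 * e by rewrite addr_gt0// mulr_gt0.
have d0 : 0 < e / (2 * B + 2 * e) by rewrite divr_gt0.
have Mg N : M (g N) = avg Phi1 (fun=> 1) (fun n => M (h n)) N by exact: mean_avg.
(* For [p]-most [N] the mean of [g N] exceeds [be - e]; as [g N] is at most [B], it must reach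
   [be - 2 * e] on a set of mean bounded below. *)
have Alarge : p [set N | e / (2 * B + 2 * e) <= M (ind (A N))].
  have bMh : bnd (fun n => M (h n)) by exact: bnd_mean.
  apply: filterS (ulim_near pU (bnd_avg Phi1 bMh) e0) => N /=.
  rewrite -Mg -[ulim p _]/be ltr_norml => /andP[hN _].
  have : M (g N) <= M (fun l => (be - 2 * e) + (2 * B + 2 * e) * ind (A N) l).
    have bi := bnd_ind (R := R) (A N).
    apply: (le_mean hM) => //; first bd.
    move=> l; rewrite /ind; case: asboolP => [_|/negP]; last by rewrite mulr0 addr0 -ltNge => /ltW.
    rewrite mulr1; move: (gB N l) beB; rewrite !ler_norml => /andP[_ ?] /andP[? _]; lra.
  have bi := bnd_ind (R := R) (A N).
  rewrite [X in _ <= X](_ : _ = be - 2 * e + (2 * B + 2 * e) * M (ind (A N))).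
    by rewrite ler_pdivrMr// => gle; lra.
  by rewrite (meanD hM) ?(mean_cst hM) ?(meanZ hM)//; bd.
have [q [s2 [qU qpos hs2 qA]]] := intersectivity hM pU pinf d0 Alarge.
have hq := is_mean_ulim (R := R) qU.
have qP : ProperFilter q := ultra_proper.
pose Phi2 := Phi1 \o s2.
pose v := shiftRp q f.
have vK n : `|v n| <= K by apply: (mean_normB hq) => m.
have bv : bnd v by exists K.
(* Second extraction, made once [q], and hence [v], is fixed. *)
have [s3 hs3 cs3] := @diagonal_extraction R nat p
  (fun m => avg Phi2 (fun=> 1) (fun n => f (n + m)%N * v n)) pU pinf
  (fun m => bnd_avg Phi2 (bndM (bnd_comp (fun n => (n + m)%N) bf) bv)).
pose Psi := Phi2 \o s3.
pose N := fmean (R := R) p Psi.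
have hs23 k : (s2 (s3 k) < s2 (s3 k.+1))%N by apply: (homo_ltn ltn_trans hs2).
have FPsi : Folner (R := R) Psi by exact: (Folner_subseq hs23 FPhi1).
have hN : is_mean N := is_mean_fmean pU FPsi.
have N_shift : forall m a, bnd a -> N (fun n => a (n + m)%N) = N a.
  by move=> m a; exact: (fmean_shift pU pinf FPsi).
have MN x y : shift_span f x -> shift_span f y -> N (fun n => x n * y n) = M (fun n => x n * y n).
  move=> sx sy; apply: (fmean_cvgn pU pinf).
  exact: (cvg_subseq hs23 (span_cvgn hM bf ffM sx sy)).
have innerE m : inner Psi (shiftR m f) v = N (fun n => f (n + m)%N * v n).
  rewrite /inner avg_mul /N (fmean_cvgn pU pinf (cs3 m)).
  by apply: cvg_lim => //; exact: (cs3 m).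
have [i qi] := ultra_color col qU.
(* For each [k], [q]-most [l] have colour [i] and lie in [A (s2 (s3 k))]; the finite average over
   [Phi1 (s2 (s3 k))] commutes with the limit along [q] that defines [v]. *)
have low2 : be - 2 * e <= N (fun n => u (n + rep i)%N * v n).
  have bN := is_mean_ulim (R := R) pU.
  have buv : bnd (fun n => u (n + rep i)%N * v n) by bd.
  apply: (mean_geB bN (bnd_avg Psi buv)).
  move=> k; rewrite -[avg _ _ _ _]/(avg Phi1 (fun=> 1) (fun n => u (n + rep i)%N * v n) (s2 (s3 k))).
  have -> : (fun n => u (n + rep i)%N * v n) = (fun n => ulim q (fun l => u (n + rep i)%N * f (n + l)%N)).
    by apply/funext => n; rewrite (meanZ hq)//; bd.
  rewrite -(mean_avg hq); last by move=> n; bd.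
  apply: (ulim_ge qU).
    by exists B => l; apply: avg_normB => n; rewrite normrM ler_pM.
  apply: filterS (filterI qi (qA (s3 k))) => l [/= cl]; rewrite /A /g /h /= cl.
  exact.
exists Psi, q; split.
  exists (s1 \o s2 \o s3); split => // k /=.
  by apply: (homo_ltn ltn_trans hs1); exact: hs23.
split => //; split.
  (* A principal [q] would contain a singleton, whose indicator vanishes after a shift by [n.+1]. *)
  move=> n qn; have : q [set n] by rewrite qn => x ->.
  move=> /qpos; rewrite -/M -(M_shift n.+1 _ (bnd_ind _)) (eq_mean (G := fun=> 0)).
    by rewrite (mean_cst hM) ltxx.
  move=> x; rewrite /ind asboolF//= => xn.
  by have := leq_addl x n.+1; rewrite xn ltnn.
split.
  by move=> m _; rewrite /inner_exists avg_mul; apply/cvg_ex; eexists; exact: (cs3 m).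
have -> : inner Psi (fun=> 1) f = al.
  apply: cvg_lim => //; exact: (cvg_subseq hs23 (cvg_subseq hs1 fcvg)).
rewrite (eq_mean (G := fun m => N (fun n => f (n + m)%N * v n))) => [|m]; last exact: innerE.
have bad : M (ind [set m | 2 * (e * K) < `|N (fun n => (f (n + m)%N - u (n + m)%N) * v n)|]) = 0.
  apply: (@mean_bad_set _ M N f u v K e) => //.
  move=> d dd0; have [u' [X [su' ? ? ? ?]]] := happ d dd0.
  by exists u', X.
(* The bad set is null for [M], so its complement belongs to [q]. *)
have qgood := in_ultra_setVsetC [set m | 2 * (e * K) < `|N (fun n => (f (n + m)%N - u (n + m)%N) * v n)|] qU.
case: qgood => [/qpos|qgood]; first by rewrite -/M bad ltxx.
apply: (ulim_ge qU); first by bd.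
apply: filterS (filterI qi qgood) => m [/= cm /negP]; rewrite -leNgt => hm.
have colm : col m = col (rep i) by rewrite -[in RHS]cm repK.
have v2 : N (fun n => v n ^+ 2) <= K ^+ 2.
  apply: (mean_leB hN) => [|n]; first bd.
  by rewrite -[X in X <= _]real_normK ?num_real// lerXn2r ?nnegrE// ltW.
have h1 : `|N (fun n => (u (n + m)%N - u (n + rep i)%N) * v n)| <= e * K.
  apply: (mean_sqM_le hN) => //; try bd; try exact: ltW.
  have sd := spanB (span_shifted m su) (span_shifted (rep i) su).
  rewrite (eq_mean (G := fun n => (u (n + m)%N - u (n + rep i)%N) * (u (n + m)%N - u (n + rep i)%N))).
    rewrite (MN _ _ sd sd); apply: le_trans (hcol _ _ colm).
    by rewrite (eq_mean (G := fun n => (u (n + m)%N - u (n + rep i)%N) ^+ 2)).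
  by move=> n; rewrite expr2.
(* In order: the weakly mixing error, the variation of [u] within its colour class, and the main
   term of [low2]. *)
have -> : N (fun n => f (n + m)%N * v n) = N (fun n => (f (n + m)%N - u (n + m)%N) * v n) +
    N (fun n => (u (n + m)%N - u (n + rep i)%N) * v n) + N (fun n => u (n + rep i)%N * v n).
  by rewrite -!(meanD hN); try bd; apply: eq_mean => n; ring.
have epsE : eps = 12 * K ^+ 2 * e by rewrite /e mulrC divfK// gt_eqF.
have KK : K <= K ^+ 2 by rewrite expr2 ler_peMl// ltW.
have K2e : K * e <= K ^+ 2 * e by rewrite ler_wpM2r// ltW.
have e1 : e <= K * e by rewrite ler_peMl// ltW.
move: hm h1; rewrite !ler_norml epsE => /andP[x1 _] /andP[x2 _].
lra.
Qed.
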